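(* Let $m\ge 1$, $0<\mathbf t\le\infty$, and let $u(x,t)$ be a bounded, self-adjoint ($u=u^*$) $m\times m$ matrix function satisfying the matrix KdV equation $$u_t+3(uu_x+u_xu)-u_{xxx}=0$$ on the half-strip $0\le x<\infty$, $0\le t<\mathbf t$. Assume that the corresponding matrix functions $G$ and $F$ (defined in the context) are continuously differentiable on this half-strip. Let $M(t,z)$ be the Weyl function associated with $u(\cdot,t)$, and let $r_{kj}(t,z)$ $(k,j=1,2)$ be the $m\times m$ blocks of the $2m\times 2m$ matrix function $$R(t,z)=\begin{bmatrix} r_{11}(t,z)& r_{12}(t,z) \\ r_{21}(t,z)& r_{22}(t,z)\end{bmatrix}:=T^*\big(V(0,t,\overline z)^*\big)^{-1}T .$$ Then for all $0\le t<\mathbf t$ and $z\in\mathbb C_+$, $$M(t,z)=i\Big(-i\,r_{11}(t,z)M(0,z)+r_{12}(t,z)\Big)\Big(-i\,r_{21}(t,z)M(0,z)+r_{22}(t,z)\Big)^{-1}.$$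
   Context: $\mathbb C_+=\{z\in\mathbb C:\Im z>0\}$; $I_m$ is the $m\times m$ identity matrix. Put $$G(x,t,z)=\begin{bmatrix} 0&I_m \\ u-zI_m&0\end{bmatrix},\qquad F(x,t,z)=\begin{bmatrix} u_x&-2(u+2zI_m) \\ u_{xx}-2(u+2zI_m)(u-zI_m)&-u_x\end{bmatrix}.$$ The KdV equation above is equivalent to $G_t-F_x+GF-FG=0$. ''Bounded'' means $\sup\|u(x,t)\|<\infty$ over $0\le x<\infty$, $0\le t<\mathbf t$. Put $$T=\frac1{\sqrt2}\begin{bmatrix} iI_m&I_m \\ iI_m&-I_m\end{bmatrix}$$ (a unitary matrix). $V(x,t,z)$ is the $2m\times2m$ solution of $V_t(x,t,z)=F(x,t,z)V(x,t,z)$, $V(x,0,z)=I_{2m}$. Weyl function $M(t,z)$: let $\Psi(x,t,z)$ be the $2m\times 2m$ solution of $\Psi_x=G\Psi$, $\Psi(0,t,z)=I_{2m}$, and put $\widetilde\Psi(x,t,z)=(\Psi(x,t,0)T)^{-1}\Psi(x,t,z)T$ (it is the fundamental solution of the canonical system $\widetilde\Psi_x=izJH\widetilde\Psi$, $\widetilde \Psi(0,t,z)=I_{2m}$, with $J=\begin{bmatrix} 0&I_m \\ I_m&0\end{bmatrix}$ and $H(x,t)=T^*\Psi(x,t,0)^*\begin{bmatrix} I_m&0 \\ 0&0\end{bmatrix}\Psi(x,t,0)T\ge0$). Let $\mathcal A(l,t,z)=\widetilde\Psi(l,t,\overline z)^*$ with $m\times m$ blocks $\mathcal A_{kj}$.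 For $z\in\mathbb C_+$ and $l>0$ put $$M(l,t,z)=i\big(\mathcal A_{11}P_l+\mathcal A_{12}Q_l\big)\big(\mathcal A_{21}P_l+\mathcal A_{22}Q_l\big)^{-1},$$ where $\mathcal A_{kj}=\mathcal A_{kj}(l,t,z)$ and $P_l,Q_l$ are any $m\times m$ matrix functions meromorphic in $z\in\mathbb C_+$ with $P_l^*P_l+Q_l^*Q_l>0$ and $P_l^*Q_l+Q_l^*P_l\ge0$. For bounded $u$ the limit $M(t,z)=\lim_{l\to\infty}M(l,t,z)$ exists and is independent of the choice of the pairs $P_l,Q_l$; it is called the Weyl function. It is a Herglotz function of $z\in\mathbb C_+$. *)

(* Defs.v *)
From HB Require Import structures.
From mathcomp Require Import all_boot all_order all_algebra.
From mathcomp Require Import all_classical all_reals all_analysis.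
From mathcomp Require Import complex.

Set Implicit Arguments.
Unset Strict Implicit.
Unset Printing Implicit Defensive.

Import numFieldNormedType.Exports.
Import Order.TTheory GRing.Theory Num.Theory.
Local Open Scope classical_set_scope.
Local Open Scope ring_scope.
Local Open Scope sesquilinear_scope.

(* [R[i]] carries no topology by itself; seen as a [numClosedFieldType] it gets
   the topology and normed-module structure of its norm, and so do matrices. *)
Definition Cplx (R : realType) : numClosedFieldType := R[i].

Definition toC (R : realType) (x : R) : Cplx R := Complex x 0.

Section RealVariables.
Context {R : realType}.
Local Notation C := (Cplx R).

(* Derivatives of matrix functions of a real variable, relative to a set [D]:
   two-sided in the interior of an interval [D], one-sided at an endpoint that
   belongs to it.  Values of [f] outside [D] play no role. *)
Definition diff_quot {m n} (f : R -> 'M[C]_(m, n)) (x y : R) : 'M[C]_(m, n) :=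
  toC (y - x)^-1 *: (f y - f x).

Definition is_derive_within {m n} (D : set R) (f : R -> 'M[C]_(m, n)) (x : R)
    (l : 'M[C]_(m, n)) : Prop :=
  diff_quot f x y @[y --> within D x^'] --> l.

Definition derivable_within {m n} (D : set R) (f : R -> 'M[C]_(m, n)) (x : R)
    : Prop :=
  cvg (diff_quot f x y @[y --> within D x^']).

(* Arbitrary when the limit does not exist; only used together with
   [derivable_within]. *)
Definition derive_within {m n} (D : set R) (f : R -> 'M[C]_(m, n)) (x : R)
    : 'M[C]_(m, n) :=
  lim (diff_quot f x y @[y --> within D x^']).

Definition half_line : set R := [set x | 0 <= x].
Definition times (tb : \bar R) : set R := [set t | 0 <= t /\ (t%:E < tb)%E].
Definition half_strip (tb : \bar R) : set (R * R) := half_line `*` times tb.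

Definition dx {m n} (f : R -> R -> 'M[C]_(m, n)) (x t : R) : 'M[C]_(m, n) :=
  derive_within half_line (f ^~ t) x.

Definition dt {m n} (tb : \bar R) (f : R -> R -> 'M[C]_(m, n)) (x t : R)
    : 'M[C]_(m, n) :=
  derive_within (times tb) (f x) t.

Definition continuously_differentiable {m n} (tb : \bar R)
    (f : R -> R -> 'M[C]_(m, n)) : Prop :=
  [/\ forall x t, half_strip tb (x, t) -> derivable_within half_line (f ^~ t) x,
      forall x t, half_strip tb (x, t) -> derivable_within (times tb) (f x) t,
      {within half_strip tb, continuous (fun p : R * R => dx f p.1 p.2)} &
      {within half_strip tb, continuous (fun p : R * R => dt tb f p.1 p.2)}].

End RealVariables.

Section KdV.
Context {R : realType} {m : nat}.
Local Notation C := (Cplx R).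
Variables (tb : \bar R) (u : R -> R -> 'M[C]_m).

(* The matrix norm is the maximum of the moduli of the entries; boundedness
   does not depend on the choice of a norm on m x m matrices. *)
Definition bounded_potential : Prop :=
  exists B : R, forall x t, half_strip tb (x, t) -> `|u x t| <= toC B.

Definition self_adjoint : Prop :=
  forall x t, half_strip tb (x, t) -> u x t = (u x t)^t*.

(* The derivatives occurring here exist as soon as [Gmx u] and [Fmx u] are
   continuously differentiable, since u, u_x, u_xx are read off their blocks. *)
Definition KdV : Prop :=
  forall x t, half_strip tb (x, t) ->
    dt tb u x t + 3%:R *: (u x t *m dx u x t + dx u x t *m u x t)
      - dx (dx (dx u)) x t = 0.

Definition Gmx (x t : R) (z : C) : 'M[C]_(m + m) :=
  block_mx 0 1%:M (u x t - z%:M) 0.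

Definition Fmx (x t : R) (z : C) : 'M[C]_(m + m) :=
  block_mx (dx u x t) (- 2%:R *: (u x t + (2%:R * z)%:M))
           (dx (dx u) x t
              - 2%:R *: ((u x t + (2%:R * z)%:M) *m (u x t - z%:M)))
           (- dx u x t).

Definition solves_V (V : R -> R -> C -> 'M[C]_(m + m)) : Prop :=
  forall x z, half_line x ->
    V x 0 z = 1%:M /\
    forall t, times tb t ->
      is_derive_within (times tb) (fun s => V x s z) t
        (Fmx x t z *m V x t z).

Definition solves_Psi (Psi : R -> R -> C -> 'M[C]_(m + m)) : Prop :=
  forall t z, times tb t ->
    Psi 0 t z = 1%:M /\
    forall x, half_line x ->
      is_derive_within half_line (fun y => Psi y t z) x
        (Gmx x t z *m Psi x t z).

End KdV.

Section Weyl.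
Context {R : realType} {m : nat}.
Local Notation C := (Cplx R).

Definition Tmx : 'M[C]_(m + m) :=
  (sqrtC 2%:R)^-1 *: block_mx 'i%:M 1%:M 'i%:M (- 1%:M).

Definition tPsi (Psi : R -> R -> C -> 'M[C]_(m + m)) (x t : R) (z : C)
    : 'M[C]_(m + m) :=
  invmx (Psi x t 0 *m Tmx) *m Psi x t z *m Tmx.

Definition Amx (Psi : R -> R -> C -> 'M[C]_(m + m)) (l t : R) (z : C)
    : 'M[C]_(m + m) :=
  (tPsi Psi l t z^*)^t*.

Definition holomorphic_at (f : C -> 'M[C]_m) (z : C) : Prop :=
  forall i j, \forall w \near z, derivable (fun v : C => f v i j) w 1.

(* Meromorphic on the open upper half-plane: at each point, [f] is either
   holomorphic (n = 0) or has a pole of exact order n > 0.  The value given by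
   the total function [f] at a pole is arbitrary. *)
Definition meromorphic (f : C -> 'M[C]_m) : Prop :=
  forall z0 : C, 0 < 'Im z0 ->
    exists (n : nat) (g : C -> 'M[C]_m),
      [/\ holomorphic_at g z0,
          n = 0%N -> f z0 = g z0,
          (0 < n)%N -> g z0 != 0 &
          \forall w \near z0^', f w = (w - z0) ^- n *: g w].

(* The order of [C] makes 0 < c mean "c is real and positive", so these imply
   that [A] is Hermitian. *)
Definition posdefmx (A : 'M[C]_m) : Prop :=
  forall v : 'cV[C]_m, v != 0 -> 0 < (v^t* *m A *m v) 0 0.
Definition possemidefmx (A : 'M[C]_m) : Prop :=
  forall v : 'cV[C]_m, 0 <= (v^t* *m A *m v) 0 0.

Definition admissible_pair (P Q : C -> 'M[C]_m) : Prop :=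
  [/\ meromorphic P, meromorphic Q &
      forall z : C, 0 < 'Im z -> holomorphic_at P z -> holomorphic_at Q z ->
        posdefmx ((P z)^t* *m P z + (Q z)^t* *m Q z) /\
        possemidefmx ((P z)^t* *m Q z + (Q z)^t* *m P z)].

Definition lin_frac (A : 'M[C]_(m + m)) (P Q : 'M[C]_m) : 'M[C]_m :=
  'i *: ((ulsubmx A *m P + ursubmx A *m Q)
           *m invmx (dlsubmx A *m P + drsubmx A *m Q)).

(* At a pole of [P] or [Q], M(l,t,z) has a removable singularity and its value
   there is the limit from the neighbouring points. *)
Definition Mapprox (Psi : R -> R -> C -> 'M[C]_(m + m)) (P Q : C -> 'M[C]_m)
    (l t : R) (z : C) : 'M[C]_m :=
  if `[< holomorphic_at P z /\ holomorphic_at Q z >]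
  then lin_frac (Amx Psi l t z) (P z) (Q z)
  else lim (lin_frac (Amx Psi l t w) (P w) (Q w) @[w --> z^']).

(* [M] is the Weyl function at time [t]: the limit of M(l,t,z) as l tends to
   infinity, for every choice of the admissible pairs P_l, Q_l. *)
Definition is_Weyl_function (Psi : R -> R -> C -> 'M[C]_(m + m)) (t : R)
    (M : C -> 'M[C]_m) : Prop :=
  forall z : C, 0 < 'Im z ->
    forall P Q : R -> C -> 'M[C]_m,
      (forall l : R, 0 < l -> admissible_pair (P l) (Q l)) ->
      Mapprox Psi (P l) (Q l) l t z @[l --> +oo] --> M z.

Definition Rmx (V : R -> R -> C -> 'M[C]_(m + m)) (t : R) (z : C)
    : 'M[C]_(m + m) :=
  Tmx^t* *m invmx ((V 0 t z^*)^t*) *m Tmx.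

End Weyl.

(* Main.v *)
Require Import Defs.
From mathcomp Require Import all_boot all_order all_algebra.
From mathcomp Require Import all_classical all_reals all_analysis.
From mathcomp Require Import complex.
From mathcomp Require Import ring lra.
Import numFieldNormedType.Exports.
Import Order.TTheory GRing.Theory Num.Theory.
Local Open Scope ring_scope.

(* The zero curvature equation gives Psi_t = F Psi - Psi F(0,t,z), so that for
   w0 = T (I, -i M(0,z)) the function Y(x,t) = Psi(x,t,z) V(0,t,z) w0 solves both
   Y_x = G Y and Y_t = F Y.  Write Y v = (psi, psi_x) and let S = 2 Im (psi^* psi_x).
   Then S_x = -2 (Im z) |psi|^2, and S_t is bounded below by a multiple of S_x
   because u is bounded, so S is nondecreasing along the lines x + c t = const.
   Since M(0,z) lies in all the Weyl disks at time 0, S(x,0) >= 0 for all x, whence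
   S(x,t) >= 0 for all x.  This says that the fraction in the conclusion lies in all
   the Weyl disks at time t: for every l it is the value M(l,t,z) of a suitable
   admissible constant pair, so it is the limit M(t,z). *)

Set Implicit Arguments.
Unset Strict Implicit.
Unset Printing Implicit Defensive.

Local Open Scope classical_set_scope.
Local Open Scope sesquilinear_scope.

(** Differentiability of [Psi] in t is not given, so Psi_t is obtained as a limit of difference
    quotients. These satisfy a perturbed linear equation in x. The candidate F Psi - Psi F(0,t,z)
    solves the limiting equation by zero curvature and vanishes at x = 0, so Gronwall's inequality
    forces convergence, uniformly on bounded x-intervals. S_t alone has no sign, because Re z and
    psi^* u psi can have either sign. Subtracting c S_x adds 2 c (Im z) |psi|^2, which absorbs both.
    In S_t all terms with u_x and u_xx cancel, so the bound on u alone determines c. The slanted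
    line that ends at (l,t) starts at (l + c t, 0) and never leaves the half-strip. Hence positivity
    at time 0 suffices, and nothing has to be known along the boundary x = 0. The price is that
    positivity is needed at time 0 for all x, which is what membership in all the Weyl disks
    provides. *)

Definition reC {R : realType} (z : Cplx R) : R := complex.Re z.
Definition imC {R : realType} (z : Cplx R) : R := complex.Im z.

(** * Entrywise limits of complex matrix functions *)

Section Limits.
Context {R : realType} {T : Type} {F : set_system T} {FF : Filter F}.
Local Notation C := (Cplx R).

Lemma cvg_mxP m n (f : T -> 'M[C]_(m, n)) (A : 'M[C]_(m, n)) :
  f x @[x --> F] --> A <-> forall i j, f x i j @[x --> F] --> A i j.
Proof.
split=> [fA i j|fA].
  exact: (cvg_comp _ _ fA (@coord_continuous _ _ _ i j A)).
apply/cvgrPdist_lt => e e0.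
suff /filterS : \forall x \near F, forall i j, `|A i j - f x i j| < e.
  apply=> x H; have : ball A e (f x).
    by split=> // i j; rewrite /ball /=; exact: H.
  by rewrite mx_norm_ball.
apply: filter_forall => i; apply: filter_forall => j.
by have /cvgrPdist_lt/(_ e e0) := fA i j.
Qed.

Lemma cvg_sumr (I : Type) (r : seq I) (f : I -> T -> C) (a : I -> C) :
  (forall i, f i x @[x --> F] --> a i) ->
  \sum_(i <- r) f i x @[x --> F] --> \sum_(i <- r) a i.
Proof.
move=> fa; elim: r => [|i r IH].
  by rewrite big_nil; under eq_fun do rewrite big_nil; exact: cvg_cst.
rewrite big_cons; under eq_fun do rewrite big_cons.
exact: (cvgD (fa i) IH).
Qed.

Lemma cvg_mulmx m n p (f : T -> 'M[C]_(m, n)) (g : T -> 'M[C]_(n, p))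
    (A : 'M[C]_(m, n)) (B : 'M[C]_(n, p)) :
  f x @[x --> F] --> A -> g x @[x --> F] --> B ->
  f x *m g x @[x --> F] --> A *m B.
Proof.
move=> /cvg_mxP fA /cvg_mxP gB; apply/cvg_mxP => i j.
rewrite mxE; under eq_fun do rewrite mxE.
by apply: cvg_sumr => k; exact: (cvgM (fA i k) (gB k j)).
Qed.

Lemma cvg_conj (f : T -> C) (a : C) : f x @[x --> F] --> a ->
  (f x)^* @[x --> F] --> a^*.
Proof.
move=> /cvgrPdist_lt fa; apply/cvgrPdist_lt => e /fa; apply: filterS => x.
by rewrite -rmorphB norm_conjC.
Qed.

Lemma cvg_trmxC m n (f : T -> 'M[C]_(m, n)) (A : 'M[C]_(m, n)) :
  f x @[x --> F] --> A ->
  (f x)^t* @[x --> F] --> A^t*.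
Proof.
move=> /cvg_mxP fA; apply/cvg_mxP => i j; rewrite !mxE.
by under eq_fun do rewrite !mxE; exact: (cvg_conj (fA j i)).
Qed.

Lemma normCE (z : C) :
  `|z| = toC (Num.sqrt (reC z ^+ 2 + imC z ^+ 2)).
Proof. by rewrite normc_def. Qed.

Lemma toC_le (a b : R) : (toC a <= toC b) = (a <= b).
Proof. exact: lecR. Qed.

Lemma toC_lt (a b : R) : (toC a < toC b) = (a < b).
Proof. exact: ltcR. Qed.

Lemma normRe (z : C) : toC `|reC z| <= `|z|.
Proof. exact: normc_ge_Re. Qed.

Lemma cvg_Re (f : T -> C) (a : C) : f x @[x --> F] --> a ->
  reC (f x) @[x --> F] --> reC a.
Proof.
move=> /cvgrPdist_lt fa; apply/cvgrPdist_lt => e e0.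
have /fa : 0 < toC e by rewrite -(toC_lt 0 e) in e0.
apply: filterS => x H; rewrite -toC_lt; apply: le_lt_trans H.
suff -> : reC a - reC (f x) = reC (a - f x).
  exact: normRe.
by rewrite /reC; case: a (f x) {fa} => ? ? [].
Qed.

End Limits.

(** * Derivatives relative to a subset of the line *)

Section WithinDerivative.
Context {R : realType}.
Local Notation C := (Cplx R).
Implicit Types (D : set R) (x y : R).

Lemma toCM (a b : R) : toC (a * b) = toC a * toC b.
Proof. by rewrite /toC; simpc. Qed.
Lemma conj_toC (a : R) : (toC a)^* = toC a.
Proof. exact: conjc_real. Qed.

Lemma toC_mulV x y : y != x -> toC (y - x) * toC (y - x)^-1 = 1 :> C.
Proof. by move=> yx; rewrite -toCM divff // subr_eq0. Qed.

Lemma near_within_dnbhs D x (P : R -> Prop) :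
  (forall y, D y -> y != x -> P y) -> \forall y \near within D x^', P y.
Proof.
move=> H; suff : nbhs x [set y | y != x -> D y -> P y] by [].
by apply: filterS (@filterT _ (nbhs x) _) => y _ yx Dy; exact: H.
Qed.

Lemma cvg_within_eq {U : topologicalType} D x (f g : R -> U) (l : U) :
  (forall y, D y -> y != x -> f y = g y) ->
  f y @[y --> within D x^'] --> l -> g y @[y --> within D x^'] --> l.
Proof.
move=> fg fl; apply: cvg_trans fl; apply: near_eq_cvg.
exact: near_within_dnbhs.
Qed.

Lemma cvg_toC_dist D x : toC (y - x) @[y --> within D x^'] --> (0 : C).
Proof.
apply/cvgrPdist_lt => e e0.
(* A positive element of [C] is real, so the radius equals its real part. *)
have e0' : 0 < reC e by move: e0; rewrite ltcE /= => /andP[].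
have eE : e = toC (reC e).
  by case: e e0 {e0'} => a b; rewrite ltcE /= => /andP[/eqP-> _].
have : \forall y \near x, `|x - y| < reC e.
  exact: (nbhsx_ballx x (reC e) e0').
move=> /nbhs_dnbhs /(@cvg_within _ _ _ D); apply: filterS => y.
rewrite eE sub0r normrN normCE toC_lt /= expr0n addr0 sqrtr_sqr.
by rewrite distrC.
Qed.

Section Matrix.
Context {m n : nat}.
Implicit Types (f g : R -> 'M[C]_(m, n)) (l k : 'M[C]_(m, n)).

Lemma dwP D f x l : is_derive_within D f x l <->
  forall i j, toC (y - x)^-1 * (f y i j - f x i j) @[y --> within D x^'] --> l i j.
Proof.
split=> [/cvg_mxP H i j|H].
  by have := H i j; under eq_fun do rewrite !mxE.
by apply/cvg_mxP => i j; under eq_fun do rewrite !mxE; apply: H.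
Qed.

Lemma dw_quot D f x (h : R -> 'M[C]_(m, n)) l :
  (forall y, D y -> y != x -> h y = diff_quot f x y) ->
  h y @[y --> within D x^'] --> l -> is_derive_within D f x l.
Proof. exact: cvg_within_eq. Qed.

Lemma dw_sub D E f x l : E `<=` D -> is_derive_within D f x l ->
  is_derive_within E f x l.
Proof.
move=> ED; apply: cvg_trans => A; rewrite /nbhs /=.
rewrite /within /=; apply: filterS => y H Ey; exact/H/ED.
Qed.

Lemma dw_ext D f g x l : D x -> (forall y, D y -> f y = g y) ->
  is_derive_within D f x l -> is_derive_within D g x l.
Proof.
move=> Dx fg H; refine (dw_quot _ H) => y Dy _.
by rewrite /diff_quot !fg.
Qed.

Lemma dw_cvg D f x l : is_derive_within D f x l ->
  f y @[y --> within D x^'] --> f x.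
Proof.
move=> H.
suff : f y @[y --> within D x^'] --> f x + 0 *: l by rewrite scale0r addr0.
refine (cvg_within_eq _ (cvgD (cvg_cst (f x)) (cvgZ (cvg_toC_dist D x) H))).
move=> y _ yx /=.
by rewrite ?fctE /diff_quot scalerA toC_mulV // scale1r addrC subrK.
Qed.

Lemma dw_cst D (c : 'M[C]_(m, n)) x : is_derive_within D (fun=> c) x 0.
Proof.
rewrite /is_derive_within /diff_quot; under eq_fun do rewrite subrr scaler0.
exact: cvg_cst.
Qed.

Lemma dwD D f g x l k : is_derive_within D f x l -> is_derive_within D g x k ->
  is_derive_within D (fun y => f y + g y) x (l + k).
Proof.
move=> Hf Hg; refine (dw_quot _ (cvgD Hf Hg)) => y _ _ /=.
by rewrite ?fctE /diff_quot -scalerDr opprD addrACA.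
Qed.

Lemma dwN D f x l : is_derive_within D f x l ->
  is_derive_within D (fun y => - f y) x (- l).
Proof.
move=> Hf; refine (dw_quot _ (cvgN Hf)) => y _ _ /=.
by rewrite ?fctE /diff_quot -scalerN opprD.
Qed.

Lemma dwB D f g x l k : is_derive_within D f x l -> is_derive_within D g x k ->
  is_derive_within D (fun y => f y - g y) x (l - k).
Proof. by move=> Hf Hg; exact: (dwD Hf (dwN Hg)). Qed.

Lemma dwZ D f x l (c : C) : is_derive_within D f x l ->
  is_derive_within D (fun y => c *: f y) x (c *: l).
Proof.
move=> Hf; refine (dw_quot _ (cvgZ (cvg_cst c) Hf)) => y _ _ /=.
by rewrite ?fctE /diff_quot -scalerBr !scalerA mulrC.
Qed.

End Matrix.

Lemma dw_trmxC m n D (f : R -> 'M[C]_(m, n)) x l : is_derive_within D f x l ->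
  is_derive_within D (fun y => (f y)^t*) x (l^t*).
Proof.
move=> Hf; refine (dw_quot _ (cvg_trmxC Hf)) => y _ _.
rewrite /diff_quot; apply/matrixP => i j.
by rewrite !mxE rmorphM rmorphB /= conj_toC.
Qed.

Lemma dwM m n p D (f : R -> 'M[C]_(m, n)) (g : R -> 'M[C]_(n, p)) x l k :
  is_derive_within D f x l -> is_derive_within D g x k ->
  is_derive_within D (fun y => f y *m g y) x (l *m g x + f x *m k).
Proof.
move=> Hf Hg; have Hgx := dw_cvg Hg.
refine (dw_quot _ (cvgD (cvg_mulmx Hf Hgx)
  (cvg_mulmx (cvg_cst (f x)) Hg))) => y _ _ /=.
rewrite ?fctE /diff_quot -scalemxAl -scalemxAr -scalerDr; congr (_ *: _).
by rewrite mulmxBl mulmxBr addrA subrK.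
Qed.

Lemma dw_mulr m n p D (c : 'M[C]_(n, p)) (f : R -> 'M[C]_(m, n)) x k :
  is_derive_within D f x k -> is_derive_within D (fun y => f y *m c) x (k *m c).
Proof. by move=> Hf; have := dwM Hf (dw_cst D c x); rewrite mulmx0 addr0. Qed.

(** Properness says that x is an accumulation point of [D]; otherwise every matrix would be a
    derivative at x. *)
Lemma dw_unique m n D (f : R -> 'M[C]_(m, n)) x l k :
  ProperFilter (within D x^') ->
  is_derive_within D f x l -> is_derive_within D f x k -> l = k.
Proof. by move=> P; apply: cvg_unique; exact: norm_hausdorff. Qed.

Lemma derivable_withinP m n D (f : R -> 'M[C]_(m, n)) x :
  derivable_within D f x -> is_derive_within D f x (derive_within D f x).
Proof. by []. Qed.

Lemma dw_derivable m n D (f : R -> 'M[C]_(m, n)) x l :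
  is_derive_within D f x l -> derivable_within D f x.
Proof. by move=> H; apply/cvg_ex; exists l. Qed.

Lemma dw_usubmx m1 m2 n D (f : R -> 'M[C]_(m1 + m2, n)) x l :
  is_derive_within D f x l ->
  is_derive_within D (fun y => usubmx (f y)) x (usubmx l).
Proof.
move=> /dwP H; apply/dwP => i j; rewrite !mxE; under eq_fun do rewrite !mxE.
exact: H.
Qed.

Section Blocks.
Context {m1 m2 n1 n2 : nat}.

Lemma dw_ulsubmx D (f : R -> 'M[C]_(m1 + m2, n1 + n2)) x l :
  is_derive_within D f x l ->
  is_derive_within D (fun y => ulsubmx (f y)) x (ulsubmx l).
Proof.
move=> /dwP H; apply/dwP => i j; rewrite !mxE; under eq_fun do rewrite !mxE.
exact: H.
Qed.

Lemma dw_dlsubmx D (f : R -> 'M[C]_(m1 + m2, n1 + n2)) x l :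
  is_derive_within D f x l ->
  is_derive_within D (fun y => dlsubmx (f y)) x (dlsubmx l).
Proof.
move=> /dwP H; apply/dwP => i j; rewrite !mxE; under eq_fun do rewrite !mxE.
exact: H.
Qed.

Lemma dw_block D (a : R -> 'M[C]_(m1, n1)) (b : R -> 'M[C]_(m1, n2))
    (c : R -> 'M[C]_(m2, n1)) (d : R -> 'M[C]_(m2, n2)) x a' b' c' d' :
  is_derive_within D a x a' -> is_derive_within D b x b' ->
  is_derive_within D c x c' -> is_derive_within D d x d' ->
  is_derive_within D (fun y => block_mx (a y) (b y) (c y) (d y)) x
    (block_mx a' b' c' d').
Proof.
move=> /dwP Ha /dwP Hb /dwP Hc /dwP Hd; apply/dwP => i j.
case: (splitP i) => i' ii'; case: (splitP j) => j' jj'.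
all: rewrite ?(val_inj (ii' : val i = lshift _ i')) ?(val_inj (ii' : val i = rshift _ i')).
all: rewrite ?(val_inj (jj' : val j = lshift _ j')) ?(val_inj (jj' : val j = rshift _ j')).
all: rewrite ?block_mxEul ?block_mxEur ?block_mxEdl ?block_mxEdr.
all: under eq_fun do rewrite ?block_mxEul ?block_mxEur ?block_mxEdl ?block_mxEdr.
- exact: Ha.
- exact: Hb.
- exact: Hc.
- exact: Hd.
Qed.

End Blocks.

End WithinDerivative.

(** * Real derivatives relative to a set, monotonicity and Gronwall's inequality *)

Section RealDerivative.
Context {R : realType}.
Implicit Types (D : set R) (x y : R) (g h : R -> R).

(** Kept apart from [is_derive_within] because monotonicity arguments need the total order of [R].
    Complex functions enter through their real and imaginary parts. *)
Definition is_rderive_within D g x (d : R) : Prop :=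
  (y - x)^-1 * (g y - g x) @[y --> within D x^'] --> d.

Lemma rdw_sub D E g x d : E `<=` D -> is_rderive_within D g x d ->
  is_rderive_within E g x d.
Proof.
move=> ED; apply: cvg_trans => A; rewrite /nbhs /=.
rewrite /within /=; apply: filterS => y H Ey; exact/H/ED.
Qed.

Lemma rdw_Re m n D (f : R -> 'M[Cplx R]_(m, n)) x l i j :
  is_derive_within D f x l ->
  is_rderive_within D (fun y => reC (f y i j)) x (reC (l i j)).
Proof.
move=> /dwP /(_ i j) /cvg_Re; apply: cvg_within_eq => y _ _.
by rewrite /toC /reC; case: (f y i j) (f x i j) => ? ? [? ?] /=; rewrite mul0r subr0.
Qed.

Lemma rdw_Im m n D (f : R -> 'M[Cplx R]_(m, n)) x l i j :
  is_derive_within D f x l ->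
  is_rderive_within D (fun y => imC (f y i j)) x (imC (l i j)).
Proof.
(* The imaginary part of a number is the real part of -i times it. *)
move=> H; have : is_rderive_within D
    (fun y => reC (((Complex 0 (- 1) : Cplx R) *: f y) i j)) x
    (reC (((Complex 0 (- 1) : Cplx R) *: l) i j)).
  by apply: rdw_Re; exact: dwZ.
rewrite !mxE; have E (z : Cplx R) : reC ((Complex 0 (- 1) : Cplx R) * z) = imC z.
  by rewrite /reC /imC; case: z => a b /=; rewrite mul0r mulN1r opprK add0r.
by rewrite E; apply: cvg_within_eq => y _ _; rewrite !mxE !E.
Qed.

Lemma rdw_cvg D g x d : is_rderive_within D g x d ->
  g y @[y --> within D x^'] --> g x.
Proof.
move=> H.
have yx : y - x @[y --> within D x^'] --> 0.
  have H0 : y - x @[y --> x] --> 0.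
    by rewrite -(subrr x); exact: (cvgB cvg_id (cvg_cst x)).
  move=> A /H0 /nbhs_dnbhs /(@cvg_within _ _ _ D).
  exact: filterS.
suff : g y @[y --> within D x^'] --> g x + 0 * d by rewrite mul0r addr0.
refine (cvg_within_eq _ (cvgD (cvg_cst (g x)) (cvgM yx H))).
move=> y _ yx' /=; rewrite ?fctE /=.
by rewrite mulrA divff ?subr_eq0 // mul1r addrC subrK.
Qed.

Lemma rdwN D g x d : is_rderive_within D g x d ->
  is_rderive_within D (fun y => - g y) x (- d).
Proof.
move=> Hg; refine (cvg_within_eq _ (cvgN Hg)) => y _ _ /=.
by rewrite ?fctE; ring.
Qed.

Lemma rdwD D g h x d e : is_rderive_within D g x d -> is_rderive_within D h x e ->
  is_rderive_within D (fun y => g y + h y) x (d + e).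
Proof.
move=> Hg Hh; refine (cvg_within_eq _ (cvgD Hg Hh)) => y _ _ /=.
by rewrite ?fctE; ring.
Qed.

Lemma rdwM D g h x d e : is_rderive_within D g x d -> is_rderive_within D h x e ->
  is_rderive_within D (fun y => g y * h y) x (d * h x + g x * e).
Proof.
move=> Hg Hh; have Hhx := rdw_cvg Hh.
refine (cvg_within_eq _ (cvgD (cvgM Hg Hhx) (cvgM (cvg_cst (g x)) Hh))).
by move=> y _ _ /=; rewrite ?fctE; ring.
Qed.

(** Near an interior point every y lies in [D], so the relative derivative is an ordinary one and
    the usual monotonicity theorem becomes available. *)
Lemma rdw_interior D g x d a b : a < x < b -> `[a, b] `<=` D ->
  is_rderive_within D g x d -> is_derive x 1 g d.
Proof.
move=> /andP[ax xb] abD H.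
have Dx : nbhs x D.
  apply: (filterS abD); have : x \in `]a, b[%R by rewrite in_itv /= ax.
  move=> /near_in_itvoo; apply: filterS => y; rewrite /= !in_itv /=.
  by move=> /andP[? ?]; rewrite !ltW.
have {}H : h^-1 *: ((g \o shift x) (h *: 1) - g x) @[h --> 0^'] --> d.
  move=> A /H; rewrite /nbhs /= => HA.
  have {}HA : nbhs x [set y | y != x -> A ((y - x)^-1 * (g y - g x))].
    by apply: filterS2 Dx HA => y Dy Hy yx; exact: Hy.
  have : nbhs (0 : R) [set h | h + x != x -> A ((h + x - x)^-1 * (g (h + x) - g x))].
    have /nbhs0P := HA; apply: filterS => h /=; by rewrite addrC.
  apply: filterS => h Hh h0 /=.
  have : h + x != x by rewrite -subr_eq0 addrK.
  by move=> /Hh; rewrite addrK /shift /= /GRing.scale /= mulr1.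
apply: DeriveDef; first by apply/cvg_ex; exists d.
by apply: cvg_lim H; exact: norm_hausdorff.
Qed.

Lemma is_derive_rdw D g x d : is_derive x 1 g d -> is_rderive_within D g x d.
Proof.
move=> [gx dE]; apply: (@rdw_sub setT) => //.
have H : h^-1 *: ((g \o shift x) (h *: 1) - g x) @[h --> 0^'] --> d.
  by rewrite -dE.
move=> A /H; rewrite /nbhs /= => HA.
suff : \forall y \near x, y != x -> setT y -> A ((y - x)^-1 * (g y - g x)) by [].
apply/nbhs0P; have : nbhs 0 [set h | h != 0 ->
  A (h^-1 *: ((g \o shift x) (h *: 1) - g x))] by [].
apply: filterS => h /= Hh xh _.
have h0 : h != 0 by move: xh; rewrite -subr_eq0 addrAC subrr add0r.
move: (Hh h0); rewrite /shift /= /GRing.scale /= mulr1.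
have -> : x + h - x = h by rewrite addrAC subrr add0r.
by rewrite [x + h]addrC.
Qed.

Lemma rdw_le0 D g (d : R -> R) a b : a <= b -> `[a, b] `<=` D ->
  (forall x, a <= x <= b -> is_rderive_within D g x (d x)) ->
  (forall x, a <= x <= b -> d x <= 0) -> g b <= g a.
Proof.
move=> ab abD gd d0.
have I x : x \in `]a, b[%R -> is_derive x 1 g (d x).
  rewrite in_itv /= => /andP[ax xb]; apply: (@rdw_interior D _ _ _ a b) => //.
    by rewrite ax.
  by apply: gd; rewrite !ltW.
apply: (@ler0_derive1_nincr _ g a b) => //.
- by move=> x /I [].
- move=> x xab; rewrite derive1E (@derive_val _ _ _ _ _ _ _ (I x xab)).
  by apply: d0; move: xab; rewrite in_itv /= => /andP[? ?]; rewrite !ltW.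
- apply/subspace_continuousP => x; rewrite /= in_itv /= => xab.
  move=> A Ax; have := rdw_cvg (rdw_sub abD (gd x xab)) Ax.
  rewrite /nbhs /= => H.
  have {}H : nbhs x [set y | y != x -> `[a, b] y -> A (g y)] by [].
  suff : nbhs x [set y | `[a, b] y -> A (g y)] by [].
  (* The filter of the derivative is punctured, so y = x is treated apart. *)
  apply: filterS H => y Hy yab; have [->|yx] := eqVneq y x.
    exact: nbhs_singleton.
  exact: Hy.
Qed.

(** With the integrating factor e^(-Kx), which is at most 1, the function e^(-Kx) E(x) - eta x is
    nonincreasing. The resulting bound is not sharp but needs no division by K. *)
Lemma gronwall D (E d : R -> R) (K eta X : R) : 0 <= K -> 0 <= eta -> 0 <= X ->
  `[0, X] `<=` D ->
  (forall x, 0 <= x <= X -> is_rderive_within D E x (d x)) ->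
  (forall x, 0 <= x <= X -> d x <= K * E x + eta) ->
  E 0 = 0 -> E X <= eta * X * expR (K * X).
Proof.
move=> K0 eta0 X0 XD Ed dle E0.
pose w x := expR (- (K * x)).
have wd x : is_rderive_within D w x (- K * w x).
  apply: is_derive_rdw; rewrite /w; apply: is_derive_eq.
  by rewrite /GRing.scale /=; ring.
have := @rdw_le0 D (fun x => w x * E x - eta * x)
  (fun x => (- K * w x) * E x + w x * d x - eta) 0 X X0 XD.
rewrite E0 !mulr0 subrr /w => H.
have {}H : expR (- (K * X)) * E X <= eta * X.
  rewrite -subr_le0; apply: H => x x0X.
    apply: rdwD; first by apply: rdwM => //; exact: Ed.
    apply: rdwN; apply: is_derive_rdw; apply: is_derive_eq.
    by rewrite /GRing.scale /= mulr1.
  have w1 : w x <= 1.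
    by rewrite /w -expR0 ler_expR oppr_le0 mulr_ge0 //; case/andP: x0X.
  have w0 : 0 <= w x by exact: expR_ge0.
  have := ler_wpM2l w0 (dle x x0X); have := ler_wpM2r eta0 w1.
  by rewrite /w; nra.
by move: H; rewrite mulrC expRN ler_pdivrMr ?expR_gt0.
Qed.

Lemma rdw_ge0 D g (d : R -> R) a b : a <= b -> `[a, b] `<=` D ->
  (forall x, a <= x <= b -> is_rderive_within D g x (d x)) ->
  (forall x, a <= x <= b -> 0 <= d x) -> g a <= g b.
Proof.
move=> ab abD gd d0; rewrite -lerN2.
apply: (@rdw_le0 D (fun y => - g y) (fun y => - d y)) => // x xab.
  exact/rdwN/gd.
by rewrite oppr_le0 d0.
Qed.

(** A mean value inequality: g(y) - (L + e) y is nonincreasing and g(y) + (e - L) y is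
    nondecreasing. *)
Lemma rdw_dist_le D g (d : R -> R) a b L e : a <= b -> `[a, b] `<=` D ->
  (forall x, a <= x <= b -> is_rderive_within D g x (d x)) ->
  (forall x, a <= x <= b -> `|d x - L| <= e) ->
  `|g b - g a - (b - a) * L| <= (b - a) * e.
Proof.
move=> ab abD gd dL.
have lin k x : is_rderive_within D (fun y => k * y) x k.
  by apply: is_derive_rdw; apply: is_derive_eq; rewrite /GRing.scale /= mulr1.
have H1 := @rdw_le0 D (fun y => g y + (- (L + e)) * y)
  (fun y => d y + (- (L + e))) a b ab abD.
have H2 := @rdw_ge0 D (fun y => g y + (e - L) * y)
  (fun y => d y + (e - L)) a b ab abD.
have {}H1 : g b + (- (L + e)) * b <= g a + (- (L + e)) * a.
  apply: H1 => x xab; first by apply: rdwD; [exact: gd|exact: lin].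
  by have := dL x xab; rewrite ler_norml; lra.
have {}H2 : g a + (e - L) * a <= g b + (e - L) * b.
  apply: H2 => x xab; first by apply: rdwD; [exact: gd|exact: lin].
  by have := dL x xab; rewrite ler_norml; lra.
by rewrite ler_norml; apply/andP; split; lra.
Qed.

Lemma dw0_const m n D (f : R -> 'M[Cplx R]_(m, n)) a b : a <= b ->
  `[a, b] `<=` D -> (forall x, a <= x <= b -> is_derive_within D f x 0) ->
  f b = f a.
Proof.
move=> ab abD f0; apply/matrixP => i j.
have fRe x : a <= x <= b ->
    is_rderive_within D (fun y => reC (f y i j)) x 0.
  by move=> /f0 /(@rdw_Re _ _ _ _ _ _ i j); rewrite mxE.
have fIm x : a <= x <= b ->
    is_rderive_within D (fun y => imC (f y i j)) x 0.
  by move=> /f0 /(@rdw_Im _ _ _ _ _ _ i j); rewrite mxE.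
apply/eqP; rewrite eq_complex; apply/andP; split; rewrite eq_le; apply/andP; split.
- exact: (rdw_le0 ab abD fRe).
- exact: (rdw_ge0 ab abD fRe).
- exact: (rdw_le0 ab abD fIm).
- exact: (rdw_ge0 ab abD fIm).
Qed.

End RealDerivative.

(** * Rules for the conjugate transpose *)

Section ConjugateTranspose.
Context {C : numClosedFieldType}.

Lemma trmxC_mul m n p (A : 'M[C]_(m, n)) (B : 'M[C]_(n, p)) :
  (A *m B)^t* = B^t* *m A^t*.
Proof. by rewrite trmx_mul map_mxM. Qed.

Lemma trmxCD m n (A B : 'M[C]_(m, n)) : (A + B)^t* = A^t* + B^t*.
Proof. by apply/matrixP => i j; rewrite !mxE rmorphD. Qed.

Lemma trmxCN m n (A : 'M[C]_(m, n)) : (- A)^t* = - A^t*.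
Proof. by apply/matrixP => i j; rewrite !mxE rmorphN. Qed.

Lemma trmxCZ m n (a : C) (A : 'M[C]_(m, n)) : (a *: A)^t* = a^* *: A^t*.
Proof. by apply/matrixP => i j; rewrite !mxE rmorphM. Qed.

Lemma trmxC_scalar n (a : C) : (a%:M : 'M[C]_n)^t* = (a^*)%:M.
Proof. by rewrite tr_scalar_mx map_scalar_mx. Qed.

Lemma trmxC1 n : (1%:M : 'M[C]_n)^t* = 1%:M.
Proof. by rewrite trmxC_scalar rmorph1. Qed.

Lemma trmxC0 m n : (0 : 'M[C]_(m, n))^t* = 0.
Proof. by rewrite trmx0 map_mx0. Qed.

Lemma trmxCK m n (A : 'M[C]_(m, n)) : A^t*^t* = A.
Proof. by apply/matrixP => i j; rewrite !mxE conjCK. Qed.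

Lemma trmxC_block m1 m2 n1 n2 (a : 'M[C]_(m1, n1)) (b : 'M[C]_(m1, n2))
    (c : 'M[C]_(m2, n1)) (d : 'M[C]_(m2, n2)) :
  (block_mx a b c d)^t* = block_mx (a^t*) (c^t*) (b^t*) (d^t*).
Proof. by rewrite tr_block_mx map_block_mx. Qed.

Lemma trmxC_11 (M : 'M[C]_1) : M^t* 0 0 = (M 0 0)^*.
Proof. by rewrite !mxE. Qed.

End ConjugateTranspose.

(** * Linear differential equations depending on a parameter *)

Section Modulus.
Context {R : realType}.
Local Notation C := (Cplx R).

(** The norm of [C] takes values in [C]; estimates are carried out with this real-valued modulus. *)
Definition cabs (z : C) : R := reC `|z|.

Lemma cabsE z : toC (cabs z) = `|z|.
Proof. by rewrite /cabs normCE. Qed.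

Lemma toC_inj : injective (@toC R).
Proof. by move=> a b []. Qed.

Lemma toCD (a b : R) : toC (a + b) = toC a + toC b.
Proof. by rewrite /toC; simpc. Qed.

Lemma cabs_ge0 z : 0 <= cabs z.
Proof. by rewrite -toC_le cabsE normr_ge0. Qed.

Lemma cabsM z w : cabs (z * w) = cabs z * cabs w.
Proof. by apply: toC_inj; rewrite toCM !cabsE normrM. Qed.

Lemma cabsD z w : cabs (z + w) <= cabs z + cabs w.
Proof. by rewrite -toC_le toCD !cabsE ler_normD. Qed.

Lemma cabsN z : cabs (- z) = cabs z.
Proof. by rewrite /cabs normrN. Qed.

Lemma cabs0 : cabs 0 = 0.
Proof. by rewrite /cabs normr0. Qed.

Lemma cabs_conj z : cabs z^* = cabs z.
Proof. by rewrite /cabs norm_conjC. Qed.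

Lemma cabs_toC a : cabs (toC a) = `|a|.
Proof. by rewrite /cabs normCE /= expr0n addr0 sqrtr_sqr. Qed.

Lemma cabs_sum (I : Type) (r : seq I) (P : pred I) (f : I -> C) :
  cabs (\sum_(i <- r | P i) f i) <= \sum_(i <- r | P i) cabs (f i).
Proof.
elim/big_rec2: _ => [|i x y _ H]; first by rewrite cabs0.
by apply: le_trans (cabsD _ _) _; rewrite lerD2l.
Qed.

Lemma cabs2E z : cabs z ^+ 2 = reC z ^+ 2 + imC z ^+ 2.
Proof.
by rewrite /cabs normCE /= sqr_sqrtr // addr_ge0 // sqr_ge0.
Qed.

Lemma reC_le_cabs z : reC z <= cabs z.
Proof.
apply: le_trans (ler_norm _) _.
by rewrite -toC_le cabsE; exact: normRe.
Qed.

Lemma cabs_le_ReIm z : cabs z <= `|reC z| + `|imC z|.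
Proof.
rewrite -ler_sqr ?nnegrE ?cabs_ge0 ?addr_ge0 //.
rewrite cabs2E sqrrD !real_normK ?num_real //.
by rewrite lerD2r ler_wpDr // mulrn_wge0 // mulr_ge0.
Qed.

Lemma reCD (z w : C) : reC (z + w) = reC z + reC w.
Proof. by rewrite /reC; case: z w => ? ? []. Qed.

Lemma reCN (z : C) : reC (- z) = - reC z.
Proof. by rewrite /reC; case: z. Qed.

Lemma reC_sum (I : Type) (r : seq I) (f : I -> C) :
  reC (\sum_(i <- r) f i) = \sum_(i <- r) reC (f i).
Proof. by elim/big_rec2: _ => [//|i x y _ <-]; rewrite reCD. Qed.

Lemma reC_conj (z : C) : reC z^* = reC z.
Proof. by rewrite /reC; case: z. Qed.

Definition sqn n (w : 'cV[C]_n) : R := \sum_i cabs (w i 0) ^+ 2.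

Lemma sqn_ge0 n (w : 'cV[C]_n) : 0 <= sqn w.
Proof. by apply: sumr_ge0 => i _; exact: sqr_ge0. Qed.

Lemma sqn_coord n (w : 'cV[C]_n) i : cabs (w i 0) ^+ 2 <= sqn w.
Proof.
by rewrite /sqn (bigD1 i) //= lerDl sumr_ge0 // => j _; exact: sqr_ge0.
Qed.

Lemma sqn_eq0 n (w : 'cV[C]_n) : sqn w = 0 -> w = 0.
Proof.
move=> H; apply/matrixP => i j; rewrite ord1 mxE.
have := sqn_coord w i; rewrite H => H1.
have : cabs (w i 0) ^+ 2 = 0 by apply/eqP; rewrite eq_le H1 sqr_ge0.
by move/eqP; rewrite sqrf_eq0 => /eqP /(congr1 (@toC R)); rewrite cabsE => /normr0_eq0.
Qed.

Lemma sqnE n (w : 'cV[C]_n) : (w^t* *m w) 0 0 = toC (sqn w).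
Proof.
rewrite mxE /sqn; elim/big_rec2: _ => [//|i x y _ ->].
by rewrite toCD !mxE expr2 toCM !cabsE -expr2 normCK mulrC.
Qed.

Lemma reC_dot_le n (w f : 'cV[C]_n) :
  2 * reC ((w^t* *m f) 0 0) <= sqn w + sqn f.
Proof.
rewrite mxE reC_sum mulr_sumr /sqn -big_split /=; apply: ler_sum => i _.
rewrite !mxE; have H := reC_le_cabs ((w i 0)^* * f i 0).
apply: le_trans (_ : 2 * (cabs (w i 0) * cabs (f i 0)) <= _).
  by rewrite ler_pM2l // (le_trans H) // cabsM cabs_conj.
by have := sqr_ge0 (cabs (w i 0) - cabs (f i 0)); rewrite sqrrB; lra.
Qed.

(** Each of the n^2 terms is at most B (|w_i|^2 + |w_j|^2) / 2; summing over both indices costs the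
    factor n. *)
Lemma cabs_form_le n (A : 'M[C]_n) (B : R) (w : 'cV[C]_n) : 0 <= B ->
  (forall i j, cabs (A i j) <= B) ->
  cabs ((w^t* *m A *m w) 0 0) <= n%:R * B * sqn w.
Proof.
move=> B0 AB; rewrite mxE; apply: le_trans (cabs_sum _ _ _) _.
apply: le_trans (_ : \sum_(j < n) \sum_(i < n)
  B * ((cabs (w i 0) ^+ 2 + cabs (w j 0) ^+ 2) / 2) <= _).
  apply: ler_sum => j _; rewrite cabsM mxE.
  apply: le_trans (ler_wpM2r (cabs_ge0 _) (cabs_sum _ _ _)) _.
  rewrite mulr_suml; apply: ler_sum => i _.
  rewrite !mxE cabsM cabs_conj.
  have := AB i j; have := cabs_ge0 (w i 0); have := cabs_ge0 (w j 0).
  have := cabs_ge0 (A i j).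
  move: (cabs (w i 0)) (cabs (w j 0)) (cabs (A i j)) => a b c c0 b0 a0 cB.
  apply: le_trans (_ : B * (a * b) <= _).
    by have := ler_wpM2l (mulr_ge0 a0 b0) cB; lra.
  by apply: ler_wpM2l => //; have := sqr_ge0 (a - b); rewrite sqrrB; lra.
under eq_bigr do rewrite -mulr_sumr -mulr_suml big_split /= sumr_const card_ord.
rewrite -mulr_sumr -mulr_suml big_split /= sumr_const card_ord.
by rewrite -sumrMnl -/(sqn w) -mulr_natr /sqn sumrMnl -mulr_natr; lra.
Qed.

End Modulus.

(** * Linear equations on the half-line and their dependence on a parameter *)

Section LinearODE.
Context {R : realType}.
Local Notation C := (Cplx R).

Lemma half_line_seg (X : R) : `[0, X] `<=` half_line.
Proof. by move=> x; rewrite /= in_itv /= => /andP[]. Qed.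

(** The extreme value theorem bounds each entry, and the sum of these bounds serves all entries at
    once. *)
Lemma bounded_segment m n (f : R -> 'M[C]_(m, n)) (X : R) : 0 <= X ->
  (forall x, 0 <= x <= X -> f y @[y --> within half_line x^'] --> f x) ->
  exists2 M : R, 0 <= M &
    forall x, 0 <= x <= X -> forall i j, cabs (f x i j) <= M.
Proof.
move=> X0 fc.
have /choice[M HM] (ij : 'I_m * 'I_n) :
    exists M, forall x, 0 <= x <= X -> cabs (f x ij.1 ij.2) <= M.
  have : {within `[0, X], continuous (fun x => cabs (f x ij.1 ij.2))}.
    apply/subspace_continuousP => x; rewrite /= in_itv /= => x0X.
    move=> A Ax.
    have /cvg_mxP/(_ ij.1 ij.2) /cvg_norm /cvg_Re /(_ A Ax) := fc x x0X.
    rewrite /nbhs /= => H.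
    have {}H : nbhs x [set y | y != x -> half_line y ->
      A (cabs (f y ij.1 ij.2))] by [].
    suff : nbhs x [set y | `[0, X] y -> A (cabs (f y ij.1 ij.2))] by [].
    apply: filterS H => y Hy yab; have [->|yx] := eqVneq y x.
      exact: nbhs_singleton.
    by apply: Hy => //; exact: half_line_seg yab.
  move=> /(EVT_max X0)[c _ Hc]; exists (cabs (f c ij.1 ij.2)) => x x0X.
  by apply: Hc; rewrite in_itv.
exists (\sum_ij `|M ij|); first by apply: sumr_ge0.
move=> x x0X i j; rewrite (bigD1 (i, j)) //=.
apply: le_trans (HM (i, j) x x0X) _.
by apply: le_trans (ler_norm _) _; rewrite lerDl sumr_ge0.
Qed.

(** The derivative of |w|^2 is twice the real part of the product of w with A w + f. The form bound
    contributes 2 n B |w|^2 and the cross term at most |w|^2 + |f|^2, whence the rate 2 n B + 1 in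
    Gronwall's inequality. *)
Lemma energy_bound n (w f : R -> 'cV[C]_n) (A : R -> 'M[C]_n) (B eta X : R) :
  0 <= B -> 0 <= eta -> 0 <= X ->
  (forall x, 0 <= x <= X ->
    is_derive_within half_line w x (A x *m w x + f x)) ->
  (forall x, 0 <= x <= X -> forall i j, cabs (A x i j) <= B) ->
  (forall x, 0 <= x <= X -> sqn (f x) <= eta) -> w 0 = 0 ->
  sqn (w X) <= eta * X * expR ((2 * (n%:R * B) + 1) * X).
Proof.
move=> B0 eta0 X0 wd AB fe w0.
have sqnRe v : sqn v = reC ((v^t* *m v) 0 0) :> R by rewrite sqnE.
apply: (@gronwall _ half_line (fun x => sqn (w x))
  (fun x => reC ((((A x *m w x + f x)^t* *m w x) +
     (w x)^t* *m (A x *m w x + f x)) 0 0))) => //.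
- by rewrite addr_ge0 // !mulr_ge0.
- exact: half_line_seg.
- move=> x x0X.
  have -> : (fun y => sqn (w y)) =
    fun y => reC (((w y)^t* *m w y) 0 0) by apply/funext => y.
  apply: rdw_Re; apply: dwM; [apply: dw_trmxC|]; exact: wd.
- move=> x x0X; rewrite mxE reCD.
  have -> : reC (((A x *m w x + f x)^t* *m w x) 0 0) =
      reC (((w x)^t* *m (A x *m w x + f x)) 0 0).
    rewrite -reC_conj; congr reC.
    by rewrite -trmxC_11 trmxC_mul trmxCK.
  have H1 := cabs_form_le (w x) B0 (AB x x0X).
  have H2 := reC_dot_le (w x) (f x).
  have H3 := reC_le_cabs (((w x)^t* *m A x *m w x) 0 0).
  rewrite mulmxDr mulmxA !mxE !reCD.
  have H4 := fe x x0X.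
  by move: H1 H2 H3 H4; rewrite !mxE; lra.
- by rewrite w0 /sqn big1 // => i _; rewrite mxE cabs0 expr0n.
Qed.

Lemma cabs_mulmx_le m n p (A : 'M[C]_(m, n)) (B : 'M[C]_(n, p)) (a b : R) :
  0 <= a -> (forall i j, cabs (A i j) <= a) -> (forall i j, cabs (B i j) <= b) ->
  forall i j, cabs ((A *m B) i j) <= n%:R * a * b.
Proof.
move=> a0 Aa Bb i j; rewrite mxE; apply: le_trans (cabs_sum _ _ _) _.
apply: le_trans (_ : \sum_(k < n) a * b <= _).
  by apply: ler_sum => k _; rewrite cabsM ler_pM ?cabs_ge0.
by rewrite sumr_const card_ord -[leLHS]mulr_natl mulrA.
Qed.

(* Uniformity in x is what allows a chain rule along slanted lines without
   knowing that [f] is jointly differentiable. *)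
Definition unif_quot m n (T : set R) (f : R -> R -> 'M[C]_(m, n)) (t : R)
    (d : R -> 'M[C]_(m, n)) : Prop :=
  forall X e : R, 0 <= X -> 0 < e -> \forall s \near within T t^',
    forall x, 0 <= x <= X -> forall i j,
      cabs ((diff_quot (f x) t s - d x) i j) <= e.

(** A discrete product rule. Keeping the coefficient at time s, which is bounded uniformly, leaves
    as forcing the error in the quotient of G and the term G(x,s) D - G(x,t) D, which equals s - t
    times the quotient of G times D. *)
Lemma quotient_equation N (T : set R) (G Psi : R -> R -> 'M[C]_N)
    (Gt D : R -> 'M[C]_N) (t s x : R) : s != t ->
  is_derive_within half_line (Psi^~ s) x (G x s *m Psi x s) ->
  is_derive_within half_line (Psi^~ t) x (G x t *m Psi x t) ->
  is_derive_within half_line D x (Gt x *m Psi x t + G x t *m D x) ->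
  is_derive_within half_line (fun y => diff_quot (Psi y) t s - D y) x
    (G x s *m (diff_quot (Psi x) t s - D x) +
     ((diff_quot (G x) t s - Gt x) *m Psi x t +
      toC (s - t) *: (diff_quot (G x) t s *m D x))).
Proof.
move=> st Hs Ht HD.
suff -> : G x s *m (diff_quot (Psi x) t s - D x) +
     ((diff_quot (G x) t s - Gt x) *m Psi x t +
      toC (s - t) *: (diff_quot (G x) t s *m D x)) =
    toC (s - t)^-1 *: (G x s *m Psi x s - G x t *m Psi x t) -
      (Gt x *m Psi x t + G x t *m D x).
  by exact: (dwB (dwZ (dwB Hs Ht)) HD).
rewrite /diff_quot -scalemxAl scalerA toC_mulV //.
rewrite scale1r !mulmxBl !mulmxBr -scalemxAl -scalemxAr !mulmxBl !mulmxBr.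
move: (toC (s - t)^-1) (G x s *m Psi x s) (G x t *m Psi x t)
  (Gt x *m Psi x t) (G x t *m D x) (G x s *m Psi x t) (G x s *m D x).
by move=> k A1 A2 A3 A4 A5 A6; apply/matrixP => i j; rewrite !mxE; ring.
Qed.

Lemma sqn_col_le N (A : 'M[C]_N) (b : R) (j : 'I_N) : 0 <= b ->
  (forall i j, cabs (A i j) <= b) -> sqn (A *m delta_mx j 0 : 'cV_N) <= N%:R * b ^+ 2.
Proof.
move=> b0 Ab; rewrite /sqn -colE.
apply: le_trans (_ : \sum_(i < N) b ^+ 2 <= _).
  by apply: ler_sum => i _; rewrite mxE lerXn2r ?nnegrE ?cabs_ge0.
by rewrite sumr_const card_ord -[leLHS]mulr_natl.
Qed.

(* The error e between the quotient and its candidate limit D solves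
   e_x = G(x,s) e + o(1) with e(0) = 0, so Gronwall's lemma applies. *)
Lemma unif_quot_ode N (T : set R) (G Psi : R -> R -> 'M[C]_N) (Gt D : R -> 'M[C]_N)
    (t B : R) : T t -> 0 <= B ->
  (forall s, T s -> Psi 0 s = 1%:M) ->
  (forall x s, 0 <= x -> T s ->
    is_derive_within half_line (Psi^~ s) x (G x s *m Psi x s)) ->
  (forall x s i j, 0 <= x -> T s -> cabs (G x s i j) <= B) ->
  D 0 = 0 ->
  (forall x, 0 <= x ->
    is_derive_within half_line D x (Gt x *m Psi x t + G x t *m D x)) ->
  (forall X, 0 <= X -> exists2 M, 0 <= M &
    forall x, 0 <= x <= X -> forall i j, cabs (Gt x i j) <= M) ->
  unif_quot T G t Gt -> unif_quot T Psi t D.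
Proof.
move=> Tt B0 Psi0 Psid GB D0 Dd GtB GU X e X0 e0.
have [M1 M10 HM1] : exists2 M : R, 0 <= M &
    forall x, 0 <= x <= X -> forall i j, cabs (Psi x t i j) <= M.
  by apply: bounded_segment => // x /andP[x0 _]; exact: dw_cvg (Psid x t x0 Tt).
have [M2 M20 HM2] : exists2 M : R, 0 <= M &
    forall x, 0 <= x <= X -> forall i j, cabs (D x i j) <= M.
  by apply: bounded_segment => // x /andP[x0 _]; exact: dw_cvg (Dd x x0).
have [M3 M30 HM3] := GtB X X0.
(* The Gronwall factor of [energy_bound] at the end of the interval. *)
pose K := X * expR ((2 * (N%:R * B) + 1) * X).
have K0 : 0 <= K by rewrite mulr_ge0 // expR_ge0.
have NK0 : 0 < 1 + N%:R * K by rewrite ltr_pwDl // mulr_ge0.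
(* If the forcing has entries at most [sg], then each column of the error has squared norm at most N
   sg^2 K, and this choice makes that at most e^2. Each of the two forcing terms is allowed
   [sg / 2]. *)
pose sg := e / (1 + N%:R * K).
have sg0 : 0 < sg by rewrite divr_gt0.
have p1 : 0 < 2 * N%:R * M1 + 1 by rewrite ltr_wpDl // !mulr_ge0.
have p2 : 0 < 2 * N%:R * (1 + M3) * M2 + 1.
  by rewrite ltr_wpDl // !mulr_ge0 // addr_ge0.
have near_st : \forall s \near within T t^',
    T s /\ s != t /\ `|s - t| <= sg / (2 * N%:R * (1 + M3) * M2 + 1).
  have : nbhs t (ball t (sg / (2 * N%:R * (1 + M3) * M2 + 1))).
    by apply: nbhsx_ballx; rewrite divr_gt0.
  move=> /nbhs_dnbhs /(@cvg_within _ _ _ T) H.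
  have H2 : \forall s \near within T t^', T s /\ s != t.
    exact: near_within_dnbhs.
  apply: filterS2 H H2 => s; rewrite /ball /= => H [Ts st].
  by split=> //; split=> //; rewrite distrC ltW.
(* Closeness within 1 bounds the quotients of G by [1 + M3], independently of s. *)
have HU1 := GU X 1 X0 ltr01.
have HU2 : \forall s \near within T t^', forall x, 0 <= x <= X ->
    forall i j, cabs ((diff_quot (G x) t s - Gt x) i j) <=
      sg / (2 * N%:R * M1 + 1).
  by apply: GU => //; rewrite divr_gt0.
apply: filterS3 near_st HU1 HU2 => s [Ts [st std]] HU1 HU2 x x0X i j.
pose E y := diff_quot (Psi y) t s - D y.
pose f y := (diff_quot (G y) t s - Gt y) *m Psi y t +
  toC (s - t) *: (diff_quot (G y) t s *m D y).
have fsg y : 0 <= y <= X -> forall i j, cabs (f y i j) <= sg.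
  move=> y0X k l.
  have half a : 0 <= a -> a * (sg / (2 * a + 1)) <= sg / 2.
    move=> a0; rewrite mulrA ler_pdivrMr; last by rewrite ltr_wpDl // mulr_ge0.
    by lra.
  have sg1 : 0 <= sg / (2 * N%:R * M1 + 1) by rewrite ltW // divr_gt0.
  have HP := cabs_mulmx_le sg1 (HU2 y y0X) (HM1 y y0X) k l.
  have M31 : 0 <= 1 + M3 by rewrite addr_ge0.
  have qM i' j' : cabs (diff_quot (G y) t s i' j') <= 1 + M3.
    have -> : diff_quot (G y) t s i' j' =
        (diff_quot (G y) t s - Gt y) i' j' + Gt y i' j' by rewrite !mxE subrK.
    by apply: le_trans (cabsD _ _) _; rewrite lerD ?HM3 ?HU1.
  have HQ := cabs_mulmx_le M31 qM (HM2 y y0X) k l.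
  have -> : f y k l = ((diff_quot (G y) t s - Gt y) *m Psi y t) k l +
      toC (s - t) * (diff_quot (G y) t s *m D y) k l by rewrite /f !mxE.
  apply: le_trans (cabsD _ _) _; rewrite cabsM cabs_toC [leRHS]splitr.
  apply: lerD.
    apply: le_trans HP _; rewrite mulrAC -[2 * _ * _]mulrA; apply: half.
    exact: mulr_ge0.
  apply: le_trans (_ : (sg / (2 * N%:R * (1 + M3) * M2 + 1)) *
      (N%:R * (1 + M3) * M2) <= _).
    by rewrite ler_pM ?cabs_ge0.
  by rewrite mulrC -!(mulrA 2); apply: half; rewrite !mulr_ge0.
have Ed y : 0 <= y <= X ->
    is_derive_within half_line E y (G y s *m E y + f y).
  by move=> /andP[y0 _]; apply: quotient_equation => //; auto.
have : sqn (E x *m delta_mx j 0 : 'cV_N) <=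
    (N%:R * sg ^+ 2) * x * expR ((2 * (N%:R * B) + 1) * x).
  case/andP: x0X => x0 xX.
  apply: (@energy_bound N (fun y => E y *m delta_mx j 0)
    (fun y => f y *m delta_mx j 0) (fun y => G y s)) => //.
  - by rewrite mulr_ge0 // sqr_ge0.
  - move=> y /andP[y0 yx]; rewrite mulmxA -mulmxDl; apply: dw_mulr; apply: Ed.
    by rewrite y0 (le_trans yx).
  - by move=> y /andP[y0 yx] k l; apply: GB.
  - move=> y /andP[y0 yx]; apply: sqn_col_le; first exact: ltW.
    by apply: fsg; rewrite y0 (le_trans yx).
  - by rewrite /E /diff_quot !Psi0 // subrr scaler0 D0 subrr mul0mx.
move=> Hsq; rewrite -/(E x) -ler_sqr ?nnegrE ?cabs_ge0 ?(ltW e0) //.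
have -> : E x i j = (E x *m delta_mx j 0 : 'cV_N) i 0 by rewrite -colE [RHS]mxE.
apply: le_trans (sqn_coord _ i) _; apply: le_trans Hsq _.
apply: le_trans (_ : N%:R * sg ^+ 2 * K <= _).
  rewrite -mulrA; apply: ler_wpM2l; first by rewrite mulr_ge0 // sqr_ge0.
  case/andP: x0X => x0 xX; apply: ler_pM; rewrite ?expR_ge0 //.
  by rewrite ler_expR ler_wpM2l // addr_ge0 // !mulr_ge0.
have -> : e = sg * (1 + N%:R * K) by rewrite /sg divfK // gt_eqF.
have NK1 : 0 <= N%:R * K by rewrite mulr_ge0.
rewrite [leRHS]exprMn [N%:R * _ * K]mulrAC; move: (N%:R * K) (sg) NK1 => a b a0.
have H : a <= (1 + a) ^+ 2 by rewrite sqrrD; have := sqr_ge0 a; lra.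
by have := ler_wpM2l (sqr_ge0 b) H; lra.
Qed.

End LinearODE.

(** * Differentiation along slanted lines *)

Section Characteristics.
Context {R : realType}.
Local Notation C := (Cplx R).

Lemma cvg_cabs {T : Type} {F : set_system T} {FF : Filter F} (f : T -> C) (a : C) :
  f x @[x --> F] --> a <->
  forall e : R, 0 < e -> \forall x \near F, cabs (f x - a) <= e.
Proof.
split=> [/cvgrPdist_le H e e0|H].
  have /H : 0 < toC e by rewrite -(toC_lt 0 e) in e0.
  by apply: filterS => x; rewrite distrC -cabsE toC_le.
apply/cvgrPdist_le => e e0.
have e0' : 0 < reC e by move: e0; rewrite ltcE /= => /andP[].
have eE : e = toC (reC e).
  by rewrite /reC; case: e e0 {e0'} => a' b; rewrite ltcE /= => /andP[/eqP-> _].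
by apply: filterS (H _ e0') => x; rewrite eE -cabsE toC_le -cabsN opprB.
Qed.

Lemma toCN (a : R) : toC (- a) = - toC a.
Proof. by rewrite /toC; simpc. Qed.

(** Compactness of [0, X] yields one time neighbourhood in which the t-derivative is close to its
    value at t for all x; the mean value inequality transfers this to the quotients. *)
Lemma unif_quot_C1 m n (tb : \bar R) (f fd : R -> R -> 'M[C]_(m, n)) (t : R) :
  times tb t ->
  (forall x s, half_strip tb (x, s) -> is_derive_within (times tb) (f x) s (fd x s)) ->
  {within half_strip tb, continuous (fun p : R * R => fd p.1 p.2)} ->
  unif_quot (times tb) f t (fd ^~ t).
Proof.
move=> Tt fD fdc X e X0 e0.
have e20 : 0 < e / 2 by rewrite divr_gt0.
have e40 : 0 < e / 2 / 2 by rewrite divr_gt0.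
have cover : \forall s \near t, `[0, X]%classic `<=` (fun x => times tb s ->
    forall i j, cabs (fd x s i j - fd x t i j) <= e / 2).
  have := @segment_compact R 0 X.
  move=> /compact_near_coveringP/near_covering_withinP.
  move=> /(_ R (nbhs t) (fun s x => times tb s ->
    forall i j, cabs (fd x s i j - fd x t i j) <= e / 2) _); apply => x.
  rewrite /= in_itv /= => /andP[x0 xX].
  have /subspace_continuousP/(_ (x, t)) := fdc.
  have xt : half_strip tb (x, t) by [].
  move=> /(_ xt) /cvg_mxP H.
  have {H} H : \forall p \near within (half_strip tb) (nbhs (x, t)),
      forall i j, cabs (fd p.1 p.2 i j - fd x t i j) <= e / 2 / 2.
    apply: filter_forall => i; apply: filter_forall => j.
    by have /cvg_cabs := H i j; apply.
  have {H} [[U V] /= [xU tV] UV] : nbhs (x, t) [set p | half_strip tb p ->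
      forall i j, cabs (fd p.1 p.2 i j - fd x t i j) <= e / 2 / 2] by [].
  exists (U, V) => //= -[x' s] /= [Ux' Vs]; rewrite in_itv /= => /andP[x'0 _].
  move=> Ts i j.
  (* Both values are compared with the one at the centre (x, t), at the cost of e / 4 each. *)
  have H1 := UV (x', s) (conj Ux' Vs) (conj x'0 Ts) i j.
  have H2 := UV (x', t) (conj Ux' (nbhs_singleton tV)) (conj x'0 Tt) i j.
  have -> : fd x' s i j - fd x' t i j =
    (fd x' s i j - fd x t i j) - (fd x' t i j - fd x t i j) by ring.
  by apply: le_trans (cabsD _ _) _; rewrite cabsN [leRHS]splitr lerD.
move: cover => /nbhs_ballP[d /= d0 cover].
have near_s : \forall s \near within (times tb) t^', times tb s /\ s != t /\ ball t d s.
  have := nbhsx_ballx t d d0.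
  move=> /nbhs_dnbhs /(@cvg_within _ _ _ (times tb)) H.
  have H2 : \forall s \near within (times tb) t^', times tb s /\ s != t.
    exact: near_within_dnbhs.
  by apply: filterS2 H H2 => s H [Ts st].
apply: filterS near_s => s [Ts [st std]] x x0X i j.
have x0 : 0 <= x by case/andP: x0X.
have mono r : Num.min s t <= r <= Num.max s t -> times tb r /\ ball t d r.
  move: std Ts Tt; rewrite /ball /= ltr_norml => std [s0 stb] [t0 ttb].
  case: (ltgtP s t) => [lt|lt|eq]; last by move: st; rewrite eq eqxx.
    move=> /andP[sr rt]; split; last by rewrite /ball /= ltr_norml; lra.
    split; first exact: le_trans sr.
    by apply: le_lt_trans ttb; rewrite lee_fin.
  move=> /andP[tr rs]; split; last by rewrite /ball /= ltr_norml; lra.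
  split; first exact: le_trans tr.
  by apply: le_lt_trans stb; rewrite lee_fin.
have ab : Num.min s t <= Num.max s t by case: (leP s t) => // /ltW.
have sub : `[Num.min s t, Num.max s t] `<=` times tb.
  by move=> r; rewrite /= in_itv /= => /mono[].
have est (g : R -> R) (gd : R -> R) :
    (forall r, Num.min s t <= r <= Num.max s t -> is_rderive_within (times tb) g r (gd r)) ->
    (forall r, Num.min s t <= r <= Num.max s t -> `|gd r - gd t| <= e / 2) ->
    `|(s - t)^-1 * (g s - g t) - gd t| <= e / 2.
  move=> H1 H2; have H3 := rdw_dist_le ab sub H1 H2.
  have st0 : 0 < `|s - t| by rewrite normr_gt0 subr_eq0.
  rewrite -(ler_pM2l st0) -normrM.
  have -> : (s - t) * ((s - t)^-1 * (g s - g t) - gd t) =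
      g s - g t - (s - t) * gd t.
    by rewrite [LHS]mulrBr [X in X - _]mulrA divff ?subr_eq0 // mul1r.
  case: (ltgtP s t) st H3 => // [lt|lt] _ H3.
    rewrite (ltr0_norm (_ : s - t < 0)) ?subr_lt0 // opprB; apply: le_trans H3.
    by rewrite -normrN le_eqVlt; apply/orP; left; apply/eqP; congr Num.norm; ring.
  by rewrite (gtr0_norm (_ : 0 < s - t)) ?subr_gt0.
(* The mean value inequality is a real statement, so the real and imaginary parts get e / 2 each. *)
apply: le_trans (cabs_le_ReIm _) _; rewrite [leRHS]splitr.
have close r : Num.min s t <= r <= Num.max s t ->
    cabs (fd x r i j - fd x t i j) <= e / 2.
  by move=> /mono[Tr tr]; apply: cover => //=; rewrite in_itv.
have st' (a : C) : reC (toC (s - t)^-1 * a) = (s - t)^-1 * reC a /\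
    imC (toC (s - t)^-1 * a) = (s - t)^-1 * imC a.
  by rewrite /reC /imC; case: a => ? ? /=; rewrite !mul0r subr0 addr0.
apply: lerD.
  have := est (fun r => reC (f x r i j)) (fun r => reC (fd x r i j)).
  rewrite !mxE reCD reCN (st' _).1 reCD reCN; apply=> r rst.
    by apply: rdw_Re; apply: fD; split=> //=; case: (mono r rst).
  have := close r rst; apply: le_trans; rewrite -reCN -reCD.
  by rewrite -toC_le cabsE; exact: normRe.
have imCB (a b : C) : imC (a - b) = imC a - imC b.
  by rewrite /imC; case: a b => ? ? [].
have := est (fun r => imC (f x r i j)) (fun r => imC (fd x r i j)).
rewrite !mxE imCB (st' _).2 imCB; apply=> r rst.
  by apply: rdw_Im; apply: fD; split=> //=; case: (mono r rst).
have := close r rst; apply: le_trans; rewrite -imCB -ler_sqr ?nnegrE ?cabs_ge0 //.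
by rewrite cabs2E real_normK ?num_real // lerDr sqr_ge0.
Qed.

(** With x_s = l - c s, the increment splits into f(x_s, s) - f(x_s, t) and f(x_s, t) - f(x_t, t).
    The first has a moving x, which uniformity of the quotients and continuity of d handle; the
    second is an x-quotient multiplied by -c. *)
Lemma dw_characteristic m n (T E : set R) (f : R -> R -> 'M[C]_(m, n))
    (d : R -> 'M[C]_(m, n)) (fx : 'M[C]_(m, n)) (l c t : R) : 0 < c ->
  E `<=` T -> (forall s, E s -> 0 <= s /\ 0 <= l - c * s) -> E t ->
  is_derive_within half_line (f^~ t) (l - c * t) fx ->
  unif_quot T f t d ->
  d x @[x --> within half_line (l - c * t)^'] --> d (l - c * t) ->
  is_derive_within E (fun s => f (l - c * s) s) t
    (d (l - c * t) - toC c *: fx).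
Proof.
move=> c0 ET Epos Et fxd fU dc.
have l0 : 0 <= l.
  by have [t0] := Epos _ Et; rewrite subr_ge0; apply: le_trans; rewrite mulr_ge0 // ltW.
have xs : (l - c * s) @[s --> within E t^'] `=>` within half_line (l - c * t)^'.
  move=> A; rewrite {1}/nbhs /= => HA.
  have {}HA : nbhs (l - c * t) [set y | y != l - c * t -> half_line y -> A y] by [].
  have cont : (l - c * s) @[s --> t] --> l - c * t.
    exact: (cvgB (cvg_cst l) (cvgM (cvg_cst c) cvg_id)).
  have H : nbhs t [set s | l - c * s != l - c * t -> half_line (l - c * s) ->
    A (l - c * s)] := cont _ HA.
  suff : nbhs t [set s | s != t -> E s -> A (l - c * s)] by [].
  apply: filterS H => s H st Es; apply: H; last by case: (Epos s Es).
  (* Since c is nonzero, s != t gives different points x, as the punctured filter requires. *)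
  by rewrite (inj_eq (addrI _)) (inj_eq oppr_inj) (inj_eq (mulfI (lt0r_neq0 c0))).
have H1 : (diff_quot (f (l - c * s)) t s - d (l - c * s)) @[s --> within E t^'] -->
    (0 : 'M[C]_(m, n)).
  apply/cvg_mxP => i j; apply/cvg_cabs => e e0.
  have H := fU l e l0 e0.
  have HE : \forall s \near within E t^', E s by apply: near_within_dnbhs.
  have {}H : \forall s \near within E t^', forall x, 0 <= x <= l ->
      forall i j, cabs ((diff_quot (f x) t s - d x) i j) <= e.
    have {}H : nbhs t [set s | s != t -> T s -> forall x, 0 <= x <= l ->
      forall i j, cabs ((diff_quot (f x) t s - d x) i j) <= e] := H.
    suff : nbhs t [set s | s != t -> E s -> forall x, 0 <= x <= l ->
      forall i j, cabs ((diff_quot (f x) t s - d x) i j) <= e] by [].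
    by apply: filterS H => s H st Es; apply: H => //; exact: ET.
  apply: filterS2 HE H => s Es H; rewrite [X in _ - X]mxE subr0; apply: H.
  by have [s0 ->] := Epos s Es; rewrite gerBl mulr_ge0 // ltW.
have H2 := cvg_comp _ _ xs dc.
have H3 := cvg_comp _ _ xs fxd.
rewrite -[d _]add0r.
refine (dw_quot _ (cvgB (cvgD H1 H2) (cvgZ (cvg_cst (toC c)) H3))).
move=> s Es st /=; rewrite ?fctE subrK /diff_quot scalerA.
have -> : toC c * toC (l - c * s - (l - c * t))^-1 = - toC (s - t)^-1 :> C.
  rewrite -toCM -toCN; congr toC; have st0 : s - t != 0 by rewrite subr_eq0.
  have -> : l - c * s - (l - c * t) = - c * (s - t) by ring.
  by field; rewrite st0 gt_eqF.
by rewrite scaleNr opprK -scalerDr addrA subrK.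
Qed.

End Characteristics.

(** * The skew forms and the zero curvature equation *)

Section Forms.
Context {R : realType} {m : nat}.
Local Notation C := (Cplx R).

Definition Jmx : 'M[C]_(m + m) := block_mx 0 1%:M 1%:M 0.
(* [-i] times the symplectic matrix [0 I; -I 0]; it is carried to J by T. *)
Definition Kmx : 'M[C]_(m + m) := block_mx 0 (- 'i)%:M 'i%:M 0.

Lemma Jmx_sqr : Jmx *m Jmx = 1%:M.
Proof.
by rewrite mulmx_block !mulmx0 !mul0mx !mulmx1 !addr0 !add0r -scalar_mx_block.
Qed.

Lemma Kmx_sqr : Kmx *m Kmx = 1%:M.
Proof.
rewrite mulmx_block !mulmx0 !mul0mx !addr0 !add0r -!scalar_mxM.
by rewrite mulNr mulrN -expr2 sqrCi opprK -scalar_mx_block.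
Qed.

Lemma Jmx_trmxC : Jmx^t* = Jmx.
Proof. by rewrite trmxC_block !trmxC0 trmxC1. Qed.

Lemma Tmx_unitary : (Tmx : 'M[C]_(m + m))^t* *m Tmx = 1%:M.
Proof.
have E : ((sqrtC 2%:R)^-1)^* * (sqrtC 2%:R)^-1 = 2^-1 :> C.
  by rewrite mulrC -normCK normfV ger0_norm ?sqrtC_ge0 // exprVn sqrtCK.
have D2 : 2^-1 *: (1%:M + 1%:M) = 1%:M :> 'M[C]_m.
  by rewrite -mulr2n -[1%:M *+ 2]scaler_nat scalerA mulVf ?pnatr_eq0 // scale1r.
rewrite /Tmx trmxCZ -scalemxAl -scalemxAr scalerA E trmxC_block mulmx_block.
rewrite !(trmxCN, trmxC_scalar) !conjC1 !(mulNmx, mulmxN, mulmx1, mul1mx).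
rewrite -scalar_mxM conjCi mulNr -expr2 sqrCi !opprK !subrr.
rewrite scale_block_mx !scaler0 D2.
by rewrite -scalar_mx_block.
Qed.

Lemma Tmx_unitary' : (Tmx : 'M[C]_(m + m)) *m Tmx^t* = 1%:M.
Proof. exact: mulmx1C Tmx_unitary. Qed.

Lemma Tmx_Jmx : Tmx *m Jmx = Kmx *m Tmx.
Proof.
rewrite /Tmx -[(_ *: _) *m _]scalemxAl -[Kmx *m _]scalemxAr; congr (_ *: _).
rewrite !mulmx_block.
rewrite !(mulmx0, mul0mx, mulmx1, addr0, add0r, mulmxN, mulNmx) -!scalar_mxM.
by rewrite mulNr -expr2 sqrCi opprK !raddfN /= opprK.
Qed.

(** Translates the flux form of solutions of Psi_x = G Psi into the form that defines admissible
    pairs. *)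
Lemma Tmx_form : Tmx^t* *m Kmx *m Tmx = Jmx.
Proof. by rewrite -mulmxA -Tmx_Jmx mulmxA Tmx_unitary mul1mx. Qed.

End Forms.

Lemma unitmx_inj (F : fieldType) n (A : 'M[F]_n) :
  (forall v : 'cV[F]_n, A *m v = 0 -> v = 0) -> A \in unitmx.
Proof.
move=> H; rewrite -unitmx_tr -row_free_unit; apply: inj_row_free => v vA.
apply: trmx_inj; rewrite trmx0; apply: H.
by rewrite -[A]trmxK -trmx_mul vA trmx0.
Qed.

Lemma within_dnbhs_proper (R : realType) (D : set R) (x : R) :
  (forall e, 0 < e -> exists2 y, D y & y != x /\ `|x - y| < e) ->
  ProperFilter (within D x^').
Proof.
move=> H; apply: Build_ProperFilter_ex => A HA.
have {HA} : nbhs x [set y | y != x -> D y -> A y] by [].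
move=> /nbhs_ballP[e /= e0 HA].
by have [y Dy [yx xy]] := H e e0; exists y; apply: HA.
Qed.

Lemma half_line_proper (R : realType) (x : R) : 0 <= x ->
  ProperFilter (within half_line x^').
Proof.
move=> x0; apply: within_dnbhs_proper => e e0; exists (x + e / 2).
  by rewrite /half_line /= addr_ge0 // divr_ge0 // ltW.
have e2 : 0 < e / 2 by rewrite divr_gt0.
split; first by rewrite -subr_eq0 addrAC subrr add0r gt_eqF.
by rewrite opprD addrA subrr add0r normrN gtr0_norm //; lra.
Qed.

Lemma times_proper (R : realType) (tb : \bar R) (t : R) : times tb t ->
  ProperFilter (within (times tb) t^').
Proof.
move=> [t0 ttb]; apply: within_dnbhs_proper => e e0.
(* The time interval is open at [tb], so it always contains points to the right of t. *)
have [d d0 [de dtb]] : exists2 d : R, 0 < d & d < e /\ ((t + d)%:E < tb)%E.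
  case: tb ttb => [r| |] //.
    rewrite lte_fin => tr; exists (Num.min (e / 2) ((r - t) / 2)).
      by rewrite lt_min !divr_gt0 // subr_gt0.
    rewrite lte_fin; split.
      by apply: le_lt_trans (_ : e / 2 < _); [rewrite ge_min lexx|lra].
    have : Num.min (e / 2) ((r - t) / 2) <= (r - t) / 2 by rewrite ge_min lexx orbT.
    by lra.
  by move=> _; exists (e / 2); [rewrite divr_gt0|split; [lra|rewrite ltry]].
exists (t + d); first by split=> //; rewrite addr_ge0 // ltW.
split; first by rewrite -subr_eq0 addrAC subrr add0r gt_eqF.
by rewrite opprD addrA subrr add0r normrN gtr0_norm.
Qed.

(** * Block identities behind zero curvature and the skew forms *)

Section CompanionBlocks.
Context {F : fieldType} {m : nat}.
Implicit Types p q r s w : 'M[F]_m.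

Lemma mul_block_companion p q r s w :
  block_mx p q r s *m block_mx 0 1%:M w 0 = block_mx (q *m w) p (s *m w) r.
Proof. by rewrite mulmx_block !mulmx0 !mulmx1 add0r addr0 add0r addr0. Qed.

Lemma mul_companion_block p q r s w :
  block_mx 0 1%:M w 0 *m block_mx p q r s = block_mx r s (w *m p) (w *m q).
Proof. by rewrite mulmx_block !mul0mx !mul1mx !add0r !addr0. Qed.

Lemma eq_block p q r s p' q' r' s' : p = p' -> q = q' -> r = r' -> s = s' ->
  block_mx p q r s = block_mx p' q' r' s'.
Proof. by move=> -> -> -> ->. Qed.

(** Here v, a, b, c stand for u, u_x, u_xx, u_xxx. Three blocks agree identically; in the lower left
    one the terms with z cancel, and what remains is the KdV equation. *)
Lemma zero_curvature_algebra (ut v a b c : 'M[F]_m) (z : F) :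
  ut + 3%:R *: (v *m a + a *m v) - c = 0 ->
  block_mx b (- 2%:R *: a)
    (c - 2%:R *: (a *m (v - z%:M) + (v + (2%:R * z)%:M) *m a)) (- b) +
  block_mx a (- 2%:R *: (v + (2%:R * z)%:M))
    (b - 2%:R *: ((v + (2%:R * z)%:M) *m (v - z%:M))) (- a) *m
    block_mx 0 1%:M (v - z%:M) 0 =
  block_mx 0 0 ut 0 + block_mx 0 1%:M (v - z%:M) 0 *m
  block_mx a (- 2%:R *: (v + (2%:R * z)%:M))
    (b - 2%:R *: ((v + (2%:R * z)%:M) *m (v - z%:M))) (- a).
Proof.
move=> /eqP; rewrite subr_eq0 => /eqP <-.
rewrite mul_block_companion mul_companion_block !add_block_mx.
have D1 p q : p *m (q - z%:M) = p *m q - z *: p.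
  by rewrite mulmxBr mul_mx_scalar.
have D2 p q : (q - z%:M) *m p = q *m p - z *: p.
  by rewrite mulmxBl mul_scalar_mx.
have D3 p q : (p + (2%:R * z)%:M) *m q = p *m q + (2%:R * z) *: q.
  by rewrite mulmxDl mul_scalar_mx.
have D4 p : p *m (v + (2%:R * z)%:M) = p *m v + (2%:R * z) *: p.
  by rewrite mulmxDr mul_mx_scalar.
rewrite -scalemxAl -scalemxAr mulNmx D1 D1 D2 D2 D3 D3 D4.
rewrite -(scalemx1 _ (2%:R * z)).
move: (v *m v) (v *m a) (a *m v) (1%:M : 'M[F]_m) => vv va av I.
by apply: eq_block; apply/matrixP => i j; rewrite !mxE; ring.
Qed.

Lemma form_companion_algebra (v : 'M[F]_m) (k z s : F) :
  block_mx (k *: (v - s%:M)) (- k *: (0 : 'M[F]_m)) (k *: (0 : 'M[F]_m)) (- k *: 1%:M) +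
    block_mx (- k *: (v - z%:M)) (- k *: (0 : 'M[F]_m)) (k *: (0 : 'M[F]_m)) (k *: 1%:M) =
  block_mx (k * (z - s))%:M (0 : 'M[F]_m) (0 : 'M[F]_m) (0 : 'M[F]_m).
Proof.
rewrite add_block_mx -(scalemx1 _ z) -(scalemx1 _ s) -(scalemx1 _ (_ * _)).
move: (1%:M : 'M[F]_m) => I.
by apply: eq_block; apply/matrixP => i j; rewrite !mxE; ring.
Qed.

(** Here s is the conjugate of the second spectral parameter. All occurrences of a = u_x, b = u_xx
    and v^2 cancel, so the form is controlled by u alone. *)
Lemma form_kdv_algebra (v a b : 'M[F]_m) (k z s : F) :
  block_mx (k *: (b - 2%:R *: ((v - s%:M) *m (v + (2%:R * s)%:M)))) (- k *: a)
      (k *: - a) (- k *: (- 2%:R *: (v + (2%:R * s)%:M))) +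
    block_mx (- k *: (b - 2%:R *: ((v + (2%:R * z)%:M) *m (v - z%:M))))
      (- k *: - a) (k *: a) (k *: (- 2%:R *: (v + (2%:R * z)%:M))) =
  block_mx (k * (z - s) *: (2%:R *: v - (4%:R * (z + s))%:M)) 0 0
    (- (4%:R * k * (z - s)))%:M.
Proof.
have D1 : (v + (2%:R * z)%:M) *m (v - z%:M) =
    v *m v + z *: v - (2%:R * z * z) *: 1%:M.
  rewrite mulmxDl !mulmxBr mul_mx_scalar mul_scalar_mx mul_scalar_mx.
  rewrite -(scalemx1 _ z) scalerA.
  move: (v *m v) (1%:M : 'M[F]_m) => vv' I.
  by apply/matrixP => i j; rewrite !mxE; ring.
have D2 : (v - s%:M) *m (v + (2%:R * s)%:M) =
    v *m v + s *: v - (2%:R * s * s) *: 1%:M.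
  rewrite mulmxDr !mulmxBl mul_mx_scalar mul_scalar_mx mul_scalar_mx.
  rewrite -(scalemx1 _ (2%:R * s)) scalerA.
  move: (v *m v) (1%:M : 'M[F]_m) => vv' I.
  by apply/matrixP => i j; rewrite !mxE; ring.
rewrite add_block_mx D1 D2 -(scalemx1 _ (2%:R * z)) -(scalemx1 _ (2%:R * s)).
rewrite -(scalemx1 _ (4%:R * (z + s))) -(scalemx1 _ (- _)).
move: (v *m v) (1%:M : 'M[F]_m) => vv' I.
by apply: eq_block; apply/matrixP => i j; rewrite !mxE; ring.
Qed.

End CompanionBlocks.

(** * Derivatives of the potential and the zero curvature equation *)

Section KdVPotential.
Context {R : realType} {m : nat} {tb : \bar R} {u : R -> R -> 'M[Cplx R]_m}.
Local Notation C := (Cplx R).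
Context (u_bounded : bounded_potential tb u) (u_sa : self_adjoint tb u)
  (u_KdV : KdV tb u)
  (G_C1 : forall z : C, continuously_differentiable tb (fun x t => Gmx u x t z))
  (F_C1 : forall z : C, continuously_differentiable tb (fun x t => Fmx u x t z)).

(** The lower left block of G is u - z, which at z = 0 is u itself. *)
Lemma dx_potential x t : half_strip tb (x, t) ->
  is_derive_within half_line (u^~ t) x (dx u x t).
Proof.
move=> xt; have [H _ _ _] := G_C1 0; have /derivable_withinP/dw_dlsubmx := H x t xt.
move=> /dw_derivable.
have -> : (fun y => dlsubmx (Gmx u y t 0)) = u^~ t.
  by apply/funext => y; rewrite block_mxKdl raddf0 subr0.
by [].
Qed.

Lemma dxx_potential x t : half_strip tb (x, t) ->
  is_derive_within half_line (dx u ^~ t) x (dx (dx u) x t).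
Proof.
move=> xt; have [H _ _ _] := F_C1 0; have /derivable_withinP/dw_ulsubmx := H x t xt.
move=> /dw_derivable.
have -> : (fun y => ulsubmx (Fmx u y t 0)) = dx u ^~ t.
  by apply/funext => y; rewrite block_mxKul.
by [].
Qed.

Lemma dw_cubic_block x t z : half_strip tb (x, t) ->
  is_derive_within half_line
   (fun y => 2%:R *: ((u y t + (2%:R * z)%:M) *m (u y t - z%:M))) x
   (2%:R *: (dx u x t *m (u x t - z%:M) + (u x t + (2%:R * z)%:M) *m dx u x t)).
Proof.
move=> xt; apply: dwZ; apply: dwM.
  by rewrite -[dx u x t]addr0; exact: (dwD (dx_potential xt) (dw_cst _ _ _)).
by rewrite -[dx u x t]subr0; exact: (dwB (dx_potential xt) (dw_cst _ _ _)).
Qed.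

(** The function u_xx is the lower left block of F plus the cubic block, and both are differentiable
    in x. *)
Lemma dxxx_potential x t : half_strip tb (x, t) ->
  is_derive_within half_line (dx (dx u) ^~ t) x (dx (dx (dx u)) x t).
Proof.
move=> xt; have [H _ _ _] := F_C1 0.
have H' := dwD (dw_dlsubmx (derivable_withinP (H x t xt))) (@dw_cubic_block x t 0 xt).
apply: derivable_withinP; apply: (dw_derivable (dw_ext _ _ H')).
  by case: xt.
by move=> y _; rewrite /Fmx block_mxKdl subrK.
Qed.

Lemma dt_Gmx x t z : half_strip tb (x, t) ->
  is_derive_within (times tb) (fun s => Gmx u x s z) t
    (dt tb (fun y s => Gmx u y s z) x t) /\
  dt tb (fun y s => Gmx u y s z) x t = block_mx 0 0 (dt tb u x t) 0.
Proof.
move=> xt; have [_ H _ _] := G_C1 z; have GD := derivable_withinP (H x t xt).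
split=> //; have [_ Tt] := xt; have PF := times_proper Tt.
have uD : is_derive_within (times tb) (u x) t (dt tb u x t).
  have /dw_derivable := dw_dlsubmx GD.
  have -> : (fun s => dlsubmx (Gmx u x s z)) = (fun s => u x s - z%:M).
    by apply/funext => s; rewrite block_mxKdl.
  move=> /derivable_withinP /dwD /(_ (dw_cst _ z%:M _)) /dw_derivable.
  have -> : (fun s => u x s - z%:M + z%:M) = u x.
    by apply/funext => s; rewrite subrK.
  by [].
have H1 : is_derive_within (times tb) (fun s => u x s - z%:M) t (dt tb u x t).
  by rewrite -[dt tb u x t]subr0; exact: (dwB uD (dw_cst _ _ _)).
apply: (dw_unique PF GD).
exact: (dw_block (dw_cst _ 0 _) (dw_cst _ 1%:M _) H1 (dw_cst _ 0 _)).
Qed.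

Lemma self_adjoint_dx x t : half_strip tb (x, t) -> (dx u x t)^t* = dx u x t.
Proof.
move=> [/= x0 Tt]; have PF := half_line_proper x0.
have H := @dx_potential x t (conj x0 Tt).
apply: (dw_unique PF (dw_trmxC H)); apply: dw_ext H => // y y0.
exact: u_sa (conj y0 Tt).
Qed.

Lemma self_adjoint_dxx x t : half_strip tb (x, t) ->
  (dx (dx u) x t)^t* = dx (dx u) x t.
Proof.
move=> [/= x0 Tt]; have PF := half_line_proper x0.
have H := @dxx_potential x t (conj x0 Tt).
apply: (dw_unique PF (dw_trmxC H)); apply: dw_ext H => // y y0.
by rewrite self_adjoint_dx.
Qed.

Definition dxFmx (x t : R) (z : C) : 'M[C]_(m + m) :=
  block_mx (dx (dx u) x t) (- 2%:R *: dx u x t)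
   (dx (dx (dx u)) x t -
      2%:R *: (dx u x t *m (u x t - z%:M) + (u x t + (2%:R * z)%:M) *m dx u x t))
   (- dx (dx u) x t).

Lemma dx_Fmx x t z : half_strip tb (x, t) ->
  is_derive_within half_line (fun y => Fmx u y t z) x (dxFmx x t z).
Proof.
move=> xt; apply: dw_block.
- exact: dxx_potential.
- apply: dwZ; rewrite -[dx u x t]addr0; exact: (dwD (dx_potential xt) (dw_cst _ _ _)).
- by apply: dwB; [exact: dxxx_potential|exact: dw_cubic_block].
- by apply: dwN; exact: dxx_potential.
Qed.

Lemma zero_curvature x t z : half_strip tb (x, t) ->
  dxFmx x t z + Fmx u x t z *m Gmx u x t z =
  dt tb (fun y s => Gmx u y s z) x t + Gmx u x t z *m Fmx u x t z.
Proof.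
move=> xt; have [_ ->] := @dt_Gmx x t z xt.
rewrite /dxFmx /Fmx /Gmx; apply: zero_curvature_algebra; exact: u_KdV xt.
Qed.

End KdVPotential.

(** * The K-forms of G and F *)

Section SkewForms.
Context {R : realType} {m : nat}.
Local Notation C := (Cplx R).
Local Notation K := (@Kmx R m).

Lemma form_dw p q (D : set R) (Y : R -> 'M[C]_(m + m, p)) (Z : R -> 'M[C]_(m + m, q))
    (A B : 'M[C]_(m + m)) (x : R) :
  is_derive_within D Y x (A *m Y x) -> is_derive_within D Z x (B *m Z x) ->
  is_derive_within D (fun y => (Y y)^t* *m K *m Z y) x
    ((Y x)^t* *m (A^t* *m K + K *m B) *m Z x).
Proof.
move=> HY HZ; have : is_derive_within D (fun y => (Y y)^t* *m K *m Z y) x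
    ((A *m Y x)^t* *m K *m Z x + (Y x)^t* *m K *m (B *m Z x)).
  exact: (dwM (dw_mulr (dw_trmxC HY)) HZ).
by rewrite trmxC_mul mulmxDr mulmxDl !mulmxA.
Qed.

Lemma mul_block_K (p q r t : 'M[C]_m) :
  block_mx p q r t *m K = block_mx ('i *: q) (- 'i *: p) ('i *: t) (- 'i *: r).
Proof. by rewrite mulmx_block !mulmx0 !mul_mx_scalar !add0r !addr0. Qed.

Lemma mul_K_block (p q r t : 'M[C]_m) :
  K *m block_mx p q r t = block_mx (- 'i *: r) (- 'i *: t) ('i *: p) ('i *: q).
Proof. by rewrite mulmx_block !mul0mx !mul_scalar_mx !add0r !addr0. Qed.

(** Used twice: at w = z^* the factor z - w^* vanishes and the form is conserved; at w = z the
    scalar is -2 Im z and the form is monotone. *)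
Lemma form_companion (v : 'M[C]_m) (z w : C) : v^t* = v ->
  (block_mx 0 1%:M (v - w%:M) 0)^t* *m K + K *m block_mx 0 1%:M (v - z%:M) 0 =
  block_mx ('i * (z - w^*))%:M 0 0 0.
Proof.
move=> vv; rewrite trmxC_block !trmxC0 trmxC1 trmxCD trmxCN trmxC_scalar vv.
rewrite mul_block_K mul_K_block; exact: form_companion_algebra.
Qed.

Lemma form_kdv (v a b : 'M[C]_m) (z w : C) : v^t* = v -> a^t* = a -> b^t* = b ->
  let F z := block_mx a (- 2%:R *: (v + (2%:R * z)%:M))
    (b - 2%:R *: ((v + (2%:R * z)%:M) *m (v - z%:M))) (- a) in
  (F w)^t* *m K + K *m F z =
  block_mx ('i * (z - w^*) *: (2%:R *: v - (4%:R * (z + w^*))%:M)) 0 0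
    (- (4%:R * 'i * (z - w^*)))%:M.
Proof.
move=> vv aa bb F; have E2 : (2%:R : C)^* = 2%:R by rewrite conjC_nat.
have EB : (- 2%:R *: (v + (2%:R * w)%:M))^t* =
    - 2%:R *: (v + (2%:R * w^*)%:M).
  by rewrite trmxCZ trmxCD trmxC_scalar vv rmorphN rmorphM /= !E2.
have EC : (b - 2%:R *: ((v + (2%:R * w)%:M) *m (v - w%:M)))^t* =
    b - 2%:R *: ((v - w^*%:M) *m (v + (2%:R * w^*)%:M)).
  rewrite trmxCD trmxCN trmxCZ trmxC_mul !trmxCD trmxCN !trmxC_scalar vv bb E2.
  by rewrite rmorphM /= E2.
rewrite /F trmxC_block EB EC trmxCN aa mul_block_K mul_K_block.
exact: form_kdv_algebra.
Qed.

Lemma block_diag_form (P Q : 'M[C]_m) (Y : 'cV[C]_(m + m)) :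
  Y^t* *m block_mx P 0 0 Q *m Y =
  (usubmx Y)^t* *m P *m usubmx Y + (dsubmx Y)^t* *m Q *m dsubmx Y.
Proof.
rewrite -{1 2}(vsubmxK Y) tr_col_mx map_row_mx -[in LHS]mulmxA mul_block_col.
by rewrite !mul0mx addr0 add0r mul_row_col !mulmxA.
Qed.

Lemma i_subC_conj (z : C) : 'i * (z - z^*) = toC (- 2 * imC z).
Proof.
have -> : z^* = conjc z by [].
rewrite -complexiE /toC /imC; case: z => a b.
by apply/eqP; rewrite eq_complex /=; apply/andP; split; apply/eqP; ring.
Qed.

Lemma K_unit (X Y : 'M[C]_(m + m)) : Y^t* *m K *m X = K -> X \in unitmx.
Proof.
move=> H; have : (K *m (Y^t* *m K)) *m X = 1%:M by rewrite -mulmxA H Kmx_sqr.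
by move=> /mulmx1_unit[].
Qed.

End SkewForms.

(** The left side is the x-derivative of B P - P B0 for B = F, A = G, P = Psi and B0 = F(0,t,z).
    Zero curvature turns it into the equation that [unif_quot_ode] demands of its candidate. *)
Lemma commutator_equation (F : fieldType) n (dB A B dA P B0 : 'M[F]_n) :
  dB + B *m A = dA + A *m B ->
  dB *m P + B *m (A *m P) - A *m P *m B0 = dA *m P + A *m (B *m P - P *m B0).
Proof.
by move=> H; rewrite mulmxBr !mulmxA addrA -mulmxDl H mulmxDl.
Qed.

Lemma scalar_mx0 (F : fieldType) n : (0%:M : 'M[F]_n) = 0.
Proof. by apply/matrixP => i j; rewrite !mxE mul0rn. Qed.

(** * Evolution in t *)

Section Evolution.
Context {R : realType} {m : nat} {tb : \bar R} {u : R -> R -> 'M[Cplx R]_m}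
  {V Psi : R -> R -> Cplx R -> 'M[Cplx R]_(m + m)}.
Local Notation C := (Cplx R).
Local Notation K := (@Kmx R m).
Context (u_bounded : bounded_potential tb u) (u_sa : self_adjoint tb u)
  (u_KdV : KdV tb u)
  (G_C1 : forall z : C, continuously_differentiable tb (fun x t => Gmx u x t z))
  (F_C1 : forall z : C, continuously_differentiable tb (fun x t => Fmx u x t z))
  (V_sol : solves_V tb u V) (Psi_sol : solves_Psi tb u Psi).

Lemma times_ge0 t : times tb t -> 0 <= t.
Proof. by case. Qed.

Lemma times_seg t : times tb t -> `[0, t] `<=` times tb.
Proof.
move=> [t0 ttb] s; rewrite /= in_itv /= => /andP[s0 st]; split=> //.
by apply: le_lt_trans ttb; rewrite lee_fin.
Qed.

Lemma times0 t : times tb t -> times tb 0.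
Proof. by move=> Tt; apply: (times_seg Tt); rewrite /= in_itv /= lexx times_ge0. Qed.

Lemma potential_entry_bound : exists2 B : R, 0 <= B &
  forall x t, half_strip tb (x, t) -> forall i j, cabs (u x t i j) <= B.
Proof.
(* The extra 1 makes the bound strict, as the open ball used to reach the entries requires. *)
have [B0 HB0] := u_bounded; exists (`|B0| + 1); first by rewrite addr_ge0.
move=> x t xt i j; have H := HB0 x t xt.
have : ball (0 : 'M[C]_m) (toC (`|B0| + 1)) (u x t).
  rewrite mx_norm_ball /ball_ /= sub0r normrN; apply: le_lt_trans H _.
  by rewrite toC_lt; apply: le_lt_trans (ler_norm _) _; rewrite ltrDl.
move=> [_ /(_ i j)]; rewrite /ball /= mxE sub0r normrN => /ltW.
by rewrite -cabsE toC_le.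
Qed.

Lemma Gmx_entry_bound z : exists2 B : R, 0 <= B &
  forall x t i j, 0 <= x -> times tb t -> cabs (Gmx u x t z i j) <= B.
Proof.
have [B B0 HB] := potential_entry_bound; exists (1 + B + cabs z).
  by rewrite !addr_ge0 ?cabs_ge0.
have cz := cabs_ge0 z; have c1 : cabs (1 : C) = 1.
  by apply: toC_inj; rewrite cabsE normr1.
have cb (n : nat) a (b : bool) : cabs (a *+ b : C) <= cabs a.
  by case: b; rewrite ?mulr1n // mulr0n cabs0 cabs_ge0.
move=> x t i j x0 Tt; rewrite /Gmx.
case: (splitP i) => i' ii'; case: (splitP j) => j' jj'.
all: rewrite ?(val_inj (ii' : val i = lshift _ i')) ?(val_inj (ii' : val i = rshift _ i')).
all: rewrite ?(val_inj (jj' : val j = lshift _ j')) ?(val_inj (jj' : val j = rshift _ j')).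
all: rewrite ?block_mxEul ?block_mxEur ?block_mxEdl ?block_mxEdr.
- by rewrite mxE cabs0 !addr_ge0.
- rewrite mxE; apply: le_trans (cb 0%N _ _) _; rewrite c1; lra.
- rewrite !mxE; apply: le_trans (cabsD _ _) _; rewrite cabsN.
  have := HB x t (conj x0 Tt) i' j'; have := cb 0%N z (i' == j'); lra.
- by rewrite mxE cabs0 !addr_ge0.
Qed.

Lemma dt_Gmx_bound t z X : times tb t -> 0 <= X ->
  exists2 M : R, 0 <= M & forall x, 0 <= x <= X -> forall i j,
    cabs (dt tb (fun y s => Gmx u y s z) x t i j) <= M.
Proof.
move=> Tt X0; apply: (bounded_segment X0) => x /andP[x0 _].
have [_ _ _ /subspace_continuousP/(_ (x, t) (conj x0 Tt)) H] := G_C1 z.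
move=> A /H [[U W] /= [xU tW] UW].
suff : nbhs x [set y | y != x -> half_line y ->
    A (dt tb (fun y s => Gmx u y s z) y t)] by [].
apply: filterS xU => y Uy _ y0; apply: (UW (y, t)) => //.
  by split=> //=; exact: nbhs_singleton.
Qed.

Lemma Psi_dt t z : times tb t ->
  unif_quot (times tb) (fun x s => Psi x s z) t
    (fun x => Fmx u x t z *m Psi x t z - Psi x t z *m Fmx u 0 t z).
Proof.
move=> Tt; have [B B0 HB] := Gmx_entry_bound z.
have [_ GD _ GC] := G_C1 z.
apply: (@unif_quot_ode _ _ (times tb) (fun x s => Gmx u x s z) _
  (fun x => dt tb (fun y s => Gmx u y s z) x t) _ t B) => //.
- by move=> s Ts; case: (Psi_sol z Ts).
- by move=> x s x0 Ts; have [_] := Psi_sol z Ts; apply.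
- by have [-> _] := Psi_sol z Tt; rewrite mulmx1 mul1mx subrr.
- move=> x x0; have [_ /(_ x x0) Pd] := Psi_sol z Tt.
  have xt : half_strip tb (x, t) by [].
  have ZC := @zero_curvature R m tb u u_KdV G_C1 x t z xt.
  rewrite -(commutator_equation (Psi x t z) (Fmx u 0 t z) ZC).
  exact: (dwB (dwM (@dx_Fmx R m tb u G_C1 F_C1 x t z xt) Pd) (dw_mulr Pd)).
- by move=> X X0; exact: dt_Gmx_bound.
- exact: (unif_quot_C1 (fd := fun x s => dt tb (fun y s => Gmx u y s z) x s) Tt GD GC).
Qed.

Lemma Gmx_form x t z w : half_strip tb (x, t) ->
  (Gmx u x t w)^t* *m K + K *m Gmx u x t z = block_mx ('i * (z - w^*))%:M 0 0 0.
Proof. by move=> xt; apply: form_companion; rewrite -u_sa. Qed.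

Lemma Fmx_form x t z w : half_strip tb (x, t) ->
  (Fmx u x t w)^t* *m K + K *m Fmx u x t z =
  block_mx ('i * (z - w^*) *: (2%:R *: u x t - (4%:R * (z + w^*))%:M)) 0 0
    (- (4%:R * 'i * (z - w^*)))%:M.
Proof.
move=> xt; apply: form_kdv; first by rewrite -u_sa.
  exact: (self_adjoint_dx u_sa G_C1 xt).
exact: (self_adjoint_dxx u_sa G_C1 F_C1 xt).
Qed.

(** For the parameters z^* and z the form has zero x-derivative, so it keeps its value at x = 0. *)
Lemma Psi_form x t z : half_strip tb (x, t) ->
  (Psi x t z^*)^t* *m K *m Psi x t z = K.
Proof.
move=> [/= x0 Tt]; have [P0 Pd] := Psi_sol z Tt; have [P0' Pd'] := Psi_sol z^* Tt.
rewrite (@dw0_const _ _ _ half_line (fun y => (Psi y t z^*)^t* *m K *m Psi y t z) 0 x x0).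
- by rewrite P0 P0' trmxC1 mulmx1 mul1mx.
- exact: half_line_seg.
- move=> y /andP[y0 _]; have := form_dw (Pd' y y0) (Pd y y0).
  rewrite (@Gmx_form y t z z^* (conj y0 Tt)) conjCK subrr mulr0 scalar_mx0.
  by rewrite block_mx0 mulmx0 mul0mx.
Qed.

Lemma V_form t z : times tb t -> (V 0 t z^*)^t* *m K *m V 0 t z = K.
Proof.
move=> Tt; have [V0 Vd] := V_sol z (lexx 0); have [V0' Vd'] := V_sol z^* (lexx 0).
rewrite (@dw0_const _ _ _ (times tb) (fun s => (V 0 s z^*)^t* *m K *m V 0 s z) 0 t).
- by rewrite V0 V0' trmxC1 mulmx1 mul1mx.
- exact: times_ge0.
- exact: times_seg.
- move=> s st; have Ts : times tb s by apply: (times_seg Tt); rewrite /= in_itv.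
  have := form_dw (Vd' s Ts) (Vd s Ts).
  rewrite (@Fmx_form 0 s z z^* (conj (lexx 0) Ts)) conjCK subrr !mulr0 oppr0 scale0r.
  by rewrite scalar_mx0 block_mx0 mulmx0 mul0mx.
Qed.

End Evolution.

(** The product rule for Psi V w along a slanted line: the terms with A0 = F(0,t,z) coming from
    Psi_t and V_t cancel, so the product is transported by F - c G. *)
Lemma flow_equation (F : fieldType) n p (A B A0 P v : 'M[F]_n) (w : 'M[F]_(n, p)) c :
  (A - c *: B) *m (P *m (v *m w)) =
  (A *m P - P *m A0 - c *: (B *m P)) *m (v *m w) + P *m (A0 *m v *m w).
Proof.
rewrite !mulmxBl -!scalemxAl !mulmxA.
move: (A *m P *m v *m w) (P *m A0 *m v *m w) (B *m P *m v *m w) => X Y Z.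
by apply/matrixP => i j; rewrite !mxE; ring.
Qed.

Lemma form_difference_algebra (F : fieldType) n (v : 'M[F]_n) (k s c : F) :
  block_mx (k *: (2%:R *: v - (4%:R * s)%:M)) 0 0 (- (4%:R * k))%:M -
    c *: block_mx k%:M (0 : 'M[F]_n) (0 : 'M[F]_n) 0 =
  block_mx ((2%:R * k) *: v + (- (k * (4%:R * s + c)))%:M) 0 0 (- (4%:R * k))%:M.
Proof.
rewrite scale_block_mx opp_block_mx add_block_mx -(scalemx1 _ (4%:R * s)).
rewrite -(scalemx1 _ k) -(scalemx1 _ (- (k * _))) -(scalemx1 _ (- (_ * _))).
move: (1%:M : 'M[F]_n) => I.
by apply: eq_block; apply/matrixP => i j; rewrite !mxE; ring.
Qed.

Lemma form_sub_real (R : realType) n (A B K : 'M[Cplx R]_n) (c : R) :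
  (A - toC c *: B)^t* *m K + K *m (A - toC c *: B) =
  A^t* *m K + K *m A - toC c *: (B^t* *m K + K *m B).
Proof.
rewrite trmxCD trmxCN trmxCZ conj_toC mulmxDl mulNmx mulmxBr -scalemxAl -scalemxAr.
by rewrite scalerDr opprD addrACA.
Qed.

Lemma toC_natM (R : realType) n (a : R) : toC (n%:R * a) = n%:R * toC a.
Proof. by rewrite toCM; congr (_ * _); rewrite /toC -(rmorph_nat (real_complex R)). Qed.

Lemma addC_conj (R : realType) (z : Cplx R) : z + z^* = toC (2 * reC z).
Proof.
have -> : z^* = conjc z by [].
rewrite /toC /reC; case: z => a b.
by apply/eqP; rewrite eq_complex /=; apply/andP; split; apply/eqP; ring.
Qed.

(** * The flux of a solution and its monotonicity *)

Section WeylForm.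
Context {R : realType} {m : nat} {tb : \bar R} {u : R -> R -> 'M[Cplx R]_m}
  {V Psi : R -> R -> Cplx R -> 'M[Cplx R]_(m + m)}.
Local Notation C := (Cplx R).
Local Notation K := (@Kmx R m).
Context (u_bounded : bounded_potential tb u) (u_sa : self_adjoint tb u)
  (u_KdV : KdV tb u)
  (G_C1 : forall z : C, continuously_differentiable tb (fun x t => Gmx u x t z))
  (F_C1 : forall z : C, continuously_differentiable tb (fun x t => Fmx u x t z))
  (V_sol : solves_V tb u V) (Psi_sol : solves_Psi tb u Psi).

(* For Y = (psi, psi_x) this is 2 Im (psi^* psi_x).  A vector w belongs to the
   Weyl disk of length l iff [Psi l t z *m (Tmx *m w)] has nonnegative flux. *)
Definition flux (Y : 'cV[C]_(m + m)) : R := reC ((Y^t* *m K *m Y) 0 0).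

Lemma reC_toCM (a : R) (z : C) : reC (toC a * z) = a * reC z.
Proof. by rewrite /reC; case: z => b c /=; rewrite mul0r subr0. Qed.

Lemma diag_scalar_form (a : R) (Y : 'cV[C]_m) :
  (Y^t* *m (toC a)%:M *m Y) 0 0 = toC (a * sqn Y).
Proof. by rewrite mul_mx_scalar -scalemxAl mxE sqnE toCM. Qed.

Lemma flux_dx t z w x : times tb t -> 0 <= x ->
  is_rderive_within half_line (fun y => flux (Psi y t z *m w)) x
    (- 2 * imC z * sqn (usubmx (Psi x t z *m w))).
Proof.
move=> Tt x0; have [_ /(_ x x0) Pd] := Psi_sol z Tt.
have Yd : is_derive_within half_line (fun y => Psi y t z *m w) x
    (Gmx u x t z *m (Psi x t z *m w)).
  by rewrite mulmxA; exact: dw_mulr.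
have := rdw_Re (i := 0) (j := 0) (form_dw Yd Yd).
rewrite (@Gmx_form R m tb u u_sa x t z z (conj x0 Tt)) i_subC_conj block_diag_form.
by rewrite mulmx0 mul0mx addr0 diag_scalar_form.
Qed.

(** This is the nesting of the Weyl disks: nonnegative flux at l2 forces nonnegative flux at l1. *)
Lemma flux_nincr t z w l1 l2 : times tb t -> 0 < imC z -> 0 <= l1 -> l1 <= l2 ->
  flux (Psi l2 t z *m w) <= flux (Psi l1 t z *m w).
Proof.
move=> Tt z0 l10 l12; apply: (@rdw_le0 _ half_line (fun y => flux (Psi y t z *m w))
  (fun x => - 2 * imC z * sqn (usubmx (Psi x t z *m w))) l1 l2 l12).
- by move=> x; rewrite /= in_itv /= => /andP[l1x _]; exact: le_trans l1x.
- by move=> x /andP[l1x _]; apply: flux_dx => //; exact: le_trans l1x.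
- move=> x _; rewrite mulNr mulNr oppr_le0 !mulr_ge0 ?sqn_ge0 //; exact: ltW.
Qed.

(* A flux that is constant in x forces psi = 0, because its x-derivative is
   -2 (Im z) |psi|^2. *)
Lemma flux_eq0 t z w : times tb t -> 0 < imC z ->
  (forall l, 0 <= l -> 0 <= flux (Psi l t z *m w)) -> flux w = 0 -> w = 0.
Proof.
move=> Tt z0 pos qw; have [P0 Pd] := Psi_sol z Tt.
have q0 l : 0 <= l -> flux (Psi l t z *m w) = 0.
  move=> l0; apply/eqP; rewrite eq_le pos // andbT.
  by have := flux_nincr w Tt z0 (lexx 0) l0; rewrite P0 mul1mx qw.
have u0 x : 0 <= x -> usubmx (Psi x t z *m w) = 0.
  move=> x0; apply: sqn_eq0; have PF := half_line_proper x0.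
  have Z : is_rderive_within half_line (fun y => flux (Psi y t z *m w)) x 0.
    apply: (cvg_within_eq (f := fun=> 0)); last exact: cvg_cst.
    by move=> y y0 _; rewrite !q0 // subrr mulr0.
  have : - 2 * imC z * sqn (usubmx (Psi x t z *m w)) = 0.
    exact: (cvg_unique (@norm_hausdorff _ R) (@flux_dx t z w x Tt x0) Z).
  by move/eqP; rewrite mulf_eq0 mulf_eq0 oppr_eq0 pnatr_eq0 /= gt_eqF //= => /eqP.
(* The first block row of Y_x = G Y reads psi' = psi_x, so psi = 0 on the half-line gives psi_x = 0
   at 0. *)
have d0 : dsubmx (Psi 0 t z *m w) = 0.
  have PF := half_line_proper (lexx (0 : R)).
  have H : is_derive_within half_line (fun y => usubmx (Psi y t z *m w)) 0
      (usubmx (Gmx u 0 t z *m (Psi 0 t z *m w))).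
    apply: dw_usubmx; rewrite mulmxA; apply: dw_mulr; apply: Pd; exact: lexx.
  have Z : is_derive_within half_line (fun y => usubmx (Psi y t z *m w)) 0 0.
    apply: (dw_ext (f := fun=> 0)); [by rewrite /half_line /=| |exact: dw_cst].
    by move=> y y0; rewrite u0.
  have := dw_unique PF H Z; rewrite -[X in Gmx _ _ _ _ *m X]vsubmxK.
  by rewrite /Gmx mul_block_col mul0mx add0r mul1mx col_mxKu.
have : Psi 0 t z *m w = 0 by rewrite -[LHS]vsubmxK d0 u0 // col_mx0.
by rewrite P0 mul1mx.
Qed.

(* Both flux_x = -2 (Im z) |psi|^2 and
   flux_t = 4 (Im z) (2 |psi_x|^2 + 4 (Re z) |psi|^2 - psi^* u psi) are pointwise
   expressions; u being bounded, flux_t >= c flux_x for a large c, so the flux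
   increases along the lines x + c t = const. *)
Lemma flux_characteristic z : 0 < imC z -> exists2 c : R, 0 < c &
  forall t l w, times tb t -> 0 <= l ->
    flux (Psi (l + c * t) 0 z *m w) <= flux (Psi l t z *m (V 0 t z *m w)).
Proof.
move=> z0; have [B B0 HB] := potential_entry_bound u_bounded.
(* Along the line the coefficient of 2 Im z contains (8 Re z + c) |psi|^2 - 2 psi^* u psi. The first
   two summands dominate Re z and the entry bound m B of u; the 1 makes c positive. *)
pose c := 8 * `|reC z| + 2 * (m%:R * B) + 1.
have c0 : 0 < c by rewrite ltr_wpDl // addr_ge0 // !mulr_ge0.
exists c => // t l w Tt l0.
pose L := l + c * t.
pose Y s := Psi (L - c * s) s z *m (V 0 s z *m w).
have Et s : 0 <= s <= t -> times tb s.
  by move=> st; apply: (times_seg Tt); rewrite /= in_itv.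
have Lx s : 0 <= s <= t -> 0 <= L - c * s.
  move=> /andP[s0 st]; rewrite /L -addrA -mulrBr addr_ge0 // mulr_ge0 ?subr_ge0 //.
  exact: ltW.
have Yd s : 0 <= s <= t -> is_derive_within `[0, t] Y s
    ((Fmx u (L - c * s) s z - toC c *: Gmx u (L - c * s) s z) *m Y s).
  move=> st; have Ts := Et s st; have x0 := Lx s st.
  have xs : half_strip tb (L - c * s, s) by [].
  have [_ Pd] := Psi_sol z Ts.
  have [_ Vd] := V_sol z (lexx 0).
  have Dc : (Fmx u x s z *m Psi x s z - Psi x s z *m Fmx u 0 s z)
      @[x --> within half_line (L - c * s)^'] -->
      Fmx u (L - c * s) s z *m Psi (L - c * s) s z
        - Psi (L - c * s) s z *m Fmx u 0 s z.
    exact: (dw_cvg (dwB (dwM (@dx_Fmx R m tb u G_C1 F_C1 _ s z xs) (Pd _ x0))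
      (dw_mulr (Pd _ x0)))).
  have Ed : is_derive_within `[0, t] (fun s => Psi (L - c * s) s z) s
      (Fmx u (L - c * s) s z *m Psi (L - c * s) s z
        - Psi (L - c * s) s z *m Fmx u 0 s z
        - toC c *: (Gmx u (L - c * s) s z *m Psi (L - c * s) s z)).
    have H := @dw_characteristic R (m + m) (m + m) (times tb) `[0, t] (fun x s => Psi x s z)
      (fun x => Fmx u x s z *m Psi x s z - Psi x s z *m Fmx u 0 s z)
      (Gmx u (L - c * s) s z *m Psi (L - c * s) s z) L c s c0 (times_seg Tt).
    apply: H.
    - move=> r; rewrite /= in_itv /= => rt; split; last exact: Lx.
      by case/andP: rt.
    - by rewrite /= in_itv.
    - exact: Pd.
    - exact: (Psi_dt u_bounded u_KdV G_C1 F_C1 Psi_sol).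
    - exact: Dc.
  have VwD : is_derive_within `[0, t] (fun s => V 0 s z *m w) s
      (Fmx u 0 s z *m V 0 s z *m w).
    by apply: dw_mulr; apply: (dw_sub (times_seg Tt)); exact: Vd.
  by rewrite /Y (flow_equation _ _ (Fmx u 0 s z)); exact: (dwM Ed VwD).
have := @rdw_ge0 R `[0, t] (fun s => flux (Y s)) (fun s => reC (((Y s)^t* *m
  ((Fmx u (L - c * s) s z - toC c *: Gmx u (L - c * s) s z)^t* *m K +
    K *m (Fmx u (L - c * s) s z - toC c *: Gmx u (L - c * s) s z)) *m Y s) 0 0))
  0 t (times_ge0 Tt).
have [V0 _] := V_sol z (lexx 0).
(* The endpoints: s = 0 is the point (l + c t, 0), where V is the identity, and s = t is (l, t). *)
rewrite /Y mulr0 subr0 V0 mul1mx {2}/L addrK; apply=> // s st.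
  by apply: rdw_Re; exact: form_dw (Yd s st) (Yd s st).
have xs : half_strip tb (L - c * s, s) by split=> /=; [exact: Lx|exact: Et].
have -> : (Fmx u (L - c * s) s z - toC c *: Gmx u (L - c * s) s z)^t* *m K +
    K *m (Fmx u (L - c * s) s z - toC c *: Gmx u (L - c * s) s z) =
  block_mx (toC (- 4 * imC z) *: u (L - c * s) s +
    (toC (2 * imC z * (8 * reC z + c)))%:M) 0 0 (toC (8 * imC z))%:M.
  rewrite form_sub_real (@Fmx_form R m tb u u_sa G_C1 F_C1 _ s z z xs).
  rewrite (@Gmx_form R m tb u u_sa _ s z z xs).
  have -> : 4%:R * 'i * (z - z^*) = 4%:R * ('i * (z - z^*)) :> C by ring.
  rewrite i_subC_conj addC_conj.
  move: (u (L - c * s) s) => v; set k := toC (- 2 * imC z).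
  have -> : toC (- 4 * imC z) = 2%:R * k :> C.
    by rewrite /k -toC_natM; congr toC; ring.
  have -> : toC (2 * imC z * (8 * reC z + c)) =
      - (k * (4%:R * toC (2 * reC z) + toC c)) :> C.
    by rewrite /k -toC_natM -toCD -toCM -toCN; congr toC; ring.
  have -> : toC (8 * imC z) = - (4%:R * k) :> C.
    by rewrite /k -toC_natM -toCN; congr toC; ring.
  exact: form_difference_algebra.
rewrite block_diag_form mxE reCD diag_scalar_form.
set psi := usubmx _; set psix := dsubmx _.
have -> : (psi^t* *m (toC (- 4 * imC z) *: u (L - c * s) s +
    (toC (2 * imC z * (8 * reC z + c)))%:M) *m psi) 0 0 =
  toC (- 4 * imC z) * (psi^t* *m u (L - c * s) s *m psi) 0 0 +
  toC (2 * imC z * (8 * reC z + c) * sqn psi).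
  rewrite -diag_scalar_form mulmxDr mulmxDl mxE; congr (_ + _).
  by rewrite -scalemxAr -scalemxAl mxE.
rewrite reCD reC_toCM [reC (toC _)]/reC [reC (toC _)]/reC /=.
have p1 := cabs_form_le psi B0 (HB _ _ xs).
have p2 := le_trans (reC_le_cabs _) p1.
move: (reC _) p2 (sqn_ge0 psi) (sqn_ge0 psix) => p.
move: (sqn psi) (sqn psix) => q r pq q0 r0.
have h1 : 0 <= (8 * `|reC z| + 8 * reC z) * q.
  rewrite mulr_ge0 // -mulrDr mulr_ge0 //.
  by have := ler_norm (- reC z); rewrite normrN; lra.
have h2 : 0 <= (8 * reC z + c) * q - 2 * p by rewrite /c; lra.
have h3 : 0 <= imC z * ((8 * reC z + c) * q - 2 * p) by rewrite mulr_ge0 // ltW.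
have h4 : 0 <= imC z * r by rewrite mulr_ge0 // ltW.
by lra.
Qed.

End WeylForm.

(** * Weyl disks *)

Section Pairs.
Context {R : realType} {m : nat}.
Local Notation C := (Cplx R).
Implicit Types (P Q : 'M[C]_m) (A : 'M[C]_(m + m)).

Lemma lin_fracE A P Q : lin_frac A P Q =
  'i *: (usubmx (A *m col_mx P Q) *m invmx (dsubmx (A *m col_mx P Q))).
Proof.
by rewrite /lin_frac -{5 6}(submxK A) mul_block_col col_mxKu col_mxKd.
Qed.

Lemma holomorphic_cst P (z : C) : holomorphic_at (fun=> P) z.
Proof.
move=> i j; apply: filterS (@filterT _ (nbhs z) _) => w _.
exact: derivable_cst.
Qed.

Lemma meromorphic_cst P : meromorphic (fun=> P).
Proof.
move=> z _; exists 0%N, (fun=> P); split=> //; first exact: holomorphic_cst.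
apply: filterS (@filterT _ (dnbhs z) _) => w _.
by rewrite expr0 invr1 scale1r.
Qed.

(** In the order of [C] a nonnegative number must be real; this is where H being Hermitian
    enters. *)
Lemma real_form_ge0 (n : nat) (H : 'M[C]_n) (v : 'cV[C]_n) : H^t* = H ->
  0 <= reC ((v^t* *m H *m v) 0 0) -> 0 <= (v^t* *m H *m v) 0 0.
Proof.
move=> HH; have : ((v^t* *m H *m v) 0 0)^* = (v^t* *m H *m v) 0 0.
  by rewrite -trmxC_11 !trmxC_mul trmxCK HH mulmxA.
move: (_ 0 0) => c; have -> : c^* = conjc c by [].
rewrite /reC; case: c => a b [/eqP].
rewrite -subr_eq0 -opprD oppr_eq0 -mulr2n mulrn_eq0 /= => /eqP -> a0.
by rewrite lecE /= eqxx.
Qed.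

(** The two matrices in the definition of admissibility are the Gram matrix of the column of P and Q
    and its J-form, so injectivity and a flux inequality suffice. *)
Lemma admissible_cst P Q :
  (forall v : 'cV[C]_m, col_mx P Q *m v = 0 -> v = 0) ->
  (forall v : 'cV[C]_m,
    0 <= reC (((col_mx P Q *m v)^t* *m Jmx *m (col_mx P Q *m v)) 0 0)) ->
  admissible_pair (fun=> P) (fun=> Q).
Proof.
move=> inj pos; split; [exact: meromorphic_cst|exact: meromorphic_cst|].
move=> z _ _ _; split=> v.
  move=> v0; have -> : P^t* *m P + Q^t* *m Q = (col_mx P Q)^t* *m col_mx P Q.
    by rewrite tr_col_mx map_row_mx mul_row_col.
  rewrite mulmxA -trmxC_mul -mulmxA sqnE toC_lt lt_def sqn_ge0 andbT.
  by apply: contra v0 => /eqP /sqn_eq0 /inj ->.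
have -> : P^t* *m Q + Q^t* *m P = (col_mx P Q)^t* *m Jmx *m col_mx P Q.
  rewrite tr_col_mx map_row_mx /Jmx mul_row_block !mulmx0 !mulmx1 add0r addr0.
  by rewrite mul_row_col addrC.
have -> : v^t* *m ((col_mx P Q)^t* *m Jmx *m col_mx P Q) *m v =
    (col_mx P Q *m v)^t* *m Jmx *m (col_mx P Q *m v).
  by rewrite trmxC_mul !mulmxA.
by apply: real_form_ge0; [exact: Jmx_trmxC|exact: pos].
Qed.

(** Constant pairs have no poles, so the branch defined by a limit never occurs. *)
Lemma Mapprox_cst (Psi : R -> R -> C -> 'M[C]_(m + m)) P Q (l t : R) (z : C) :
  Mapprox Psi (fun=> P) (fun=> Q) l t z = lin_frac (Amx Psi l t z) P Q.
Proof.
by rewrite /Mapprox asboolT //; split; exact: holomorphic_cst.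
Qed.

Lemma form_Jmx (n : nat) (a b c d : 'M[C]_(m, n)) :
  (col_mx a b)^t* *m Jmx *m col_mx c d = a^t* *m d + b^t* *m c.
Proof.
rewrite tr_col_mx map_row_mx /Jmx mul_row_block !mulmx0 !mulmx1 add0r addr0.
by rewrite mul_row_col addrC.
Qed.

Lemma Jmx_col (n : nat) (a b : 'M[C]_(m, n)) : Jmx *m col_mx a b = col_mx b a.
Proof. by rewrite /Jmx mul_block_col !mul0mx !mul1mx add0r addr0. Qed.

End Pairs.

Lemma invmx_form (C : numClosedFieldType) n (X H J : 'M[C]_n) :
  X \in unitmx -> X^t* *m H *m X = J -> (invmx X)^t* *m J *m invmx X = H.
Proof.
move=> Xu <-; have XI : (invmx X)^t* *m X^t* = 1%:M.
  by rewrite -trmxC_mul mulmxV // trmxC1.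
by rewrite -!mulmxA mulmxV // mulmx1 mulmxA XI mul1mx.
Qed.

Lemma sandwich_form (C : numClosedFieldType) n (X P Q T H K : 'M[C]_n) :
  X^t* *m H *m X = K ->
  (X *m P *m T)^t* *m H *m (X *m Q *m T) =
  T^t* *m P^t* *m K *m Q *m T.
Proof. by move=> <-; rewrite !trmxC_mul !mulmxA. Qed.

(** The hypothesis says that J B J is a right inverse of A; for square matrices it is also a left
    inverse. *)
Lemma swap_Jmx (R : realType) m (A B : 'M[Cplx R]_(m + m)) :
  A *m Jmx *m B = Jmx -> B *m Jmx *m A = Jmx.
Proof.
move=> ABJ; have H : A *m (Jmx *m B *m Jmx) = 1%:M.
  by rewrite !mulmxA ABJ Jmx_sqr.
have := mulmx1C H; rewrite -!mulmxA => /(congr1 (mulmx Jmx)).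
by rewrite mulmx1 [Jmx *m (Jmx *m _)]mulmxA Jmx_sqr mul1mx.
Qed.

(** * Weyl disks at a fixed time *)

Section WeylDisk.
Context {R : realType} {m : nat} {tb : \bar R} {u : R -> R -> 'M[Cplx R]_m}
  {Psi : R -> R -> Cplx R -> 'M[Cplx R]_(m + m)}.
Local Notation C := (Cplx R).
Local Notation K := (@Kmx R m).
Local Notation J := (@Jmx R m).
Context (u_sa : self_adjoint tb u) (Psi_sol : solves_Psi tb u Psi).

(** Since 0 is real, the normalising factor Psi(l,t,0) T carries the form K to J, and so it drops
    out. *)
Lemma tPsi_form l t z w : half_strip tb (l, t) ->
  (tPsi Psi l t w)^t* *m J *m tPsi Psi l t z =
  Tmx^t* *m (Psi l t w)^t* *m K *m Psi l t z *m Tmx.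
Proof.
move=> lt; pose X := Psi l t 0 *m Tmx.
have XF : X^t* *m K *m X = J.
  have := Psi_form u_sa Psi_sol 0 lt; rewrite conjC0 /X => H.
  by rewrite trmxC_mul -!mulmxA [K *m _]mulmxA [(Psi l t 0)^t* *m _]mulmxA
    [(Psi l t 0)^t* *m _]mulmxA H mulmxA Tmx_form.
have Xu : X \in unitmx.
  have : (J *m (X^t* *m K)) *m X = 1%:M by rewrite -mulmxA XF Jmx_sqr.
  by move=> /mulmx1_unit[].
have XI := invmx_form Xu XF.
by rewrite /tPsi -/X (sandwich_form _ _ _ XI).
Qed.

(** Up to J on both sides, [Amx] is the inverse of [tPsi]: the linear fractions pull data at l back
    to x = 0. *)
Lemma Amx_tPsi l t z : half_strip tb (l, t) ->
  Amx Psi l t z *m J *m tPsi Psi l t z = J.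
Proof.
move=> lt; rewrite /Amx tPsi_form // -!mulmxA.
have := Psi_form u_sa Psi_sol z lt => H.
rewrite [K *m _]mulmxA [(Psi l t z^*)^t* *m _]mulmxA.
by rewrite [(Psi l t z^*)^t* *m _]mulmxA H mulmxA Tmx_form.
Qed.

Lemma tPsi_Amx l t z : half_strip tb (l, t) ->
  tPsi Psi l t z *m J *m Amx Psi l t z = J.
Proof.
by move=> lt; apply: swap_Jmx; exact: Amx_tPsi.
Qed.

Lemma flux_tPsi l t z (w : 'cV[C]_(m + m)) : half_strip tb (l, t) ->
  flux (Psi l t z *m (Tmx *m w)) =
  reC (((tPsi Psi l t z *m w)^t* *m J *m (tPsi Psi l t z *m w)) 0 0).
Proof.
move=> lt; rewrite /flux; congr (reC (_ 0 0)).
move: (tPsi _ _ _ _) (tPsi_form z z lt) => B H.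
rewrite !trmxC_mul !mulmxA.
rewrite -[in RHS](mulmxA (w^t*)) -[in RHS](mulmxA (w^t*)) H.
by rewrite !mulmxA.
Qed.

Lemma tPsi_inj l t z (w : 'cV[C]_(m + m)) : half_strip tb (l, t) ->
  tPsi Psi l t z *m w = 0 -> w = 0.
Proof.
move=> lt H; have := Amx_tPsi z lt.
move: (Amx _ _ _ _) (tPsi _ _ _ _) H => A B Bw ABJ.
have : J *m w = 0 by rewrite -ABJ -mulmxA Bw mulmx0.
by move=> /(congr1 (mulmx J)); rewrite mulmxA Jmx_sqr mul1mx mulmx0.
Qed.

Context (t : R) (z : C) (Mt : C -> 'M[C]_m).
Context (Tt : times tb t) (z0 : 0 < imC z)
  (MW : is_Weyl_function Psi t Mt).

Lemma Im_gt0 : 0 < 'Im z.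
Proof. by rewrite -complexIm; have := z0; rewrite -(toC_lt 0). Qed.

Lemma flux_Tmx (w : 'cV[C]_(m + m)) : flux (Tmx *m w) = reC ((w^t* *m J *m w) 0 0).
Proof.
by rewrite /flux trmxC_mul -[in RHS]Tmx_form !mulmxA.
Qed.

Lemma flux_Tmx_col0 (y : 'cV[C]_m) : flux (Tmx *m col_mx 0 y) = 0.
Proof.
rewrite flux_Tmx form_Jmx trmxC0 mul0mx mulmx0 addr0 mxE.
by [].
Qed.

Lemma form_Jmx_diag (v : 'cV[C]_m) :
  reC (((col_mx 1%:M 1%:M *m v)^t* *m J *m (col_mx 1%:M 1%:M *m v)) 0 0) =
  2 * sqn v.
Proof.
rewrite mul_col_mx !mul1mx form_Jmx mxE sqnE reCD /reC /=; ring.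
Qed.

Lemma form_Jmx_swap (w : 'cV[C]_(m + m)) :
  (J *m w)^t* *m J *m (J *m w) = w^t* *m J *m w.
Proof. by rewrite trmxC_mul Jmx_trmxC -!mulmxA [J *m (J *m _)]mulmxA Jmx_sqr mul1mx. Qed.

(* The constant pair [J *m tPsi *m col_mx a b], which depends on l, gives
   M(l,t,z) the same value for all l. *)
Lemma Weyl_function_unique (a b : 'M[C]_m) :
  (forall l (v : 'cV[C]_m), 0 <= l ->
    0 <= flux (Psi l t z *m (Tmx *m (col_mx a b *m v)))) ->
  (forall v : 'cV[C]_m, col_mx a b *m v = 0 -> v = 0) ->
  a \in unitmx /\ Mt z = 'i *: (b *m invmx a).
Proof.
move=> pos inj; split.
  (* If a v = 0, the vector has zero first block and is J-isotropic; its flux vanishes at x = 0, and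
     [flux_eq0] applies. *)
  apply: unitmx_inj => v av; apply: inj.
  have /(congr1 (mulmx (Tmx^t*))) : Tmx *m (col_mx a b *m v) = 0.
    apply: (flux_eq0 u_sa Psi_sol Tt z0) => [l l0|]; first exact: pos.
    by rewrite mul_col_mx av flux_Tmx_col0.
  by rewrite mulmxA Tmx_unitary mul1mx mulmx0.
pose B l := J *m (tPsi Psi l t z *m col_mx a b).
have BE l v : B l *m v = J *m (tPsi Psi l t z *m (col_mx a b *m v)).
  by rewrite /B; move: (tPsi _ _ _ _) => X; rewrite !mulmxA.
have adm l : 0 < l -> admissible_pair (fun=> usubmx (B l)) (fun=> dsubmx (B l)).
  move=> l0; have lt : half_strip tb (l, t) by split=> //=; exact: ltW.
  apply: admissible_cst; rewrite vsubmxK => v.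
    rewrite BE => /(congr1 (mulmx J)).
    rewrite [J *m (J *m _)]mulmxA Jmx_sqr mul1mx mulmx0 => H.
    exact/inj/(tPsi_inj lt H).
  rewrite BE form_Jmx_swap -flux_tPsi //; apply: pos; exact: ltW.
have cvgM := MW Im_gt0 adm.
have PF : ProperFilter (pinfty_nbhs R) by apply: proper_pinfty_nbhs.
apply: (cvg_unique (@norm_hausdorff _ _) cvgM).
apply: cvg_near_cst; near=> l.
have l0 : 0 < l by near: l; exact: nbhs_pinfty_gt.
have lt : half_strip tb (l, t) by split=> //=; exact: ltW.
(* Here [Amx] undoes [tPsi] and leaves only the swap by J, so l disappears from the fraction. *)
have AB : Amx Psi l t z *m B l = col_mx b a.
  have := Amx_tPsi z lt; rewrite /B; move: (Amx _ _ _ _) (tPsi _ _ _ _) => A X AX.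
  by rewrite !mulmxA AX Jmx_col.
rewrite Mapprox_cst lin_fracE vsubmxK AB.
by rewrite col_mxKu col_mxKd.
Unshelve. all: end_near. Qed.

(** After rescaling by the denominator, the solution has at l the data J (I, I) y up to T, whose
    flux is 2 |y|^2. *)
Lemma Weyl_disk_approx l v : 0 < l ->
  0 <= flux (Psi l t z *m (Tmx *m
    (col_mx 1%:M (- 'i *: lin_frac (Amx Psi l t z) 1%:M 1%:M) *m v))).
Proof.
move=> l0; have lt : half_strip tb (l, t) by split=> //=; exact: ltW.
rewrite lin_fracE; move: (tPsi_Amx z lt) (flux_tPsi z ^~ lt).
move: (Amx Psi l t z) (tPsi Psi l t z) => A B BJA qfE.
set a := dsubmx _; set b := usubmx _.
have ab : col_mx a b = J *m (A *m col_mx 1%:M 1%:M).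
  by rewrite -[A *m _]vsubmxK Jmx_col.
have Bab y : B *m (col_mx a b *m y) = J *m (col_mx 1%:M 1%:M *m y).
  by rewrite ab !mulmxA BJA.
(* A kernel vector y of the denominator gives flux 0 at x = 0, hence at most 0 at l, where it equals
   2 |y|^2. *)
have au : a \in unitmx.
  apply: unitmx_inj => y ay; apply: sqn_eq0; apply/eqP.
  rewrite eq_le sqn_ge0 andbT -(ler_pM2l (ltr0Sn R 1)) mulr0.
  rewrite -form_Jmx_diag -form_Jmx_swap -Bab -qfE.
  have [P0 _] := Psi_sol z Tt.
  have := flux_nincr u_sa Psi_sol (Tmx *m (col_mx a b *m y)) Tt z0 (lexx 0) (ltW l0).
  by rewrite P0 mul1mx [X in _ <= flux (_ *m X)]mul_col_mx ay flux_Tmx_col0.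
have -> : - 'i *: ('i *: (b *m invmx a)) = b *m invmx a.
  by rewrite scalerA mulNr -expr2 sqrCi opprK scale1r.
have -> : col_mx 1%:M (b *m invmx a) *m v = col_mx a b *m (invmx a *m v).
  by rewrite mulmxA mul_col_mx mulmxV.
by rewrite qfE Bab form_Jmx_swap form_Jmx_diag mulr_ge0 // sqn_ge0.
Qed.

(** By nesting, the approximant of every length r >= l lies in the disk of length l. The disk
    condition is closed, so it passes to the limit in r. *)
Lemma Weyl_disk l (v : 'cV[C]_m) : 0 <= l ->
  0 <= flux (Psi l t z *m (Tmx *m (col_mx 1%:M (- 'i *: Mt z) *m v))).
Proof.
move=> l0.
have adm (r : R) : 0 < r -> admissible_pair (fun=> 1%:M) (fun=> 1%:M : 'M[C]_m).
  move=> _; apply: admissible_cst => w.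
    by rewrite mul_col_mx !mul1mx -col_mx0 => /eq_col_mx[].
  by rewrite form_Jmx_diag mulr_ge0 // sqn_ge0.
have cvgM := MW Im_gt0 adm.
have PF : ProperFilter (pinfty_nbhs R) by apply: proper_pinfty_nbhs.
pose W (N : 'M[C]_m) := Psi l t z *m (Tmx *m (col_mx 1%:M (- 'i *: N) *m v)).
have Wc : W (Mapprox Psi (fun=> 1%:M) (fun=> 1%:M) r t z) @[r --> +oo] --> W (Mt z).
  (* Affine dependence on N lets the limit pass through W. *)
  have WE N : W N = Psi l t z *m (Tmx *m (col_mx 1%:M 0 *m v)) +
      (Psi l t z *m (Tmx *m col_mx 0 (- 'i)%:M)) *m (N *m v).
    rewrite -!mulmxA -!mulmxDr /W; congr (_ *m (_ *m _)).
    rewrite mulmxA -mulmxDl; congr (_ *m _).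
    by rewrite mul_col_mx mul0mx mul_scalar_mx add_col_mx addr0 add0r.
  rewrite WE; under eq_fun do rewrite WE.
  exact: (cvgD (cvg_cst _) (cvg_mulmx (cvg_cst _) (cvg_mulmx cvgM (cvg_cst _)))).
have qc : flux (W (Mapprox Psi (fun=> 1%:M) (fun=> 1%:M) r t z)) @[r --> +oo] -->
    flux (W (Mt z)).
  apply: cvg_Re.
  exact: (proj1 (cvg_mxP _ _)
    (cvg_mulmx (cvg_mulmx (cvg_trmxC Wc) (cvg_cst K)) Wc) 0 0).
rewrite -/(W (Mt z)) -(cvg_lim (@norm_hausdorff _ R) qc).
apply: limr_ge; first by apply/cvg_ex; exists (flux (W (Mt z))).
near=> r.
have r0 : 0 < r by near: r; exact: nbhs_pinfty_gt.
have lr : l <= r by near: r; apply: nbhs_pinfty_ge; exact: num_real.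
rewrite Mapprox_cst; apply: le_trans (Weyl_disk_approx v r0) _.
exact: (flux_nincr u_sa Psi_sol _ Tt z0 l0 lr).
Unshelve. all: end_near. Qed.

End WeylDisk.

Lemma RmxE (R : realType) m
    (V : R -> R -> Cplx R -> 'M[Cplx R]_(m + m)) (t : R) (z : Cplx R) :
  (V 0 t z^*)^t* *m Kmx *m V 0 t z = Kmx ->
  Rmx V t z = Jmx *m (Tmx^t* *m V 0 t z *m Tmx) *m Jmx.
Proof.
rewrite /Rmx; move: (V 0 t z^*) (V 0 t z) => X Y H.
have XI : X^t* *m (Kmx *m Y *m Kmx) = 1%:M by rewrite !mulmxA H Kmx_sqr.
have [Xu _] := mulmx1_unit XI.
have -> : invmx (X^t*) = Kmx *m Y *m Kmx.
  by rewrite -[LHS]mulmx1 -XI mulKmx.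
have TK : Tmx^t* *m Kmx = Jmx *m Tmx^t* :> 'M[Cplx R]_(m + m).
  by rewrite -Tmx_form -[RHS]mulmxA Tmx_unitary' mulmx1.
by rewrite !mulmxA TK -[in LHS]mulmxA -Tmx_Jmx !mulmxA.
Qed.

(** Invertibility of the denominator is part of the conclusion because [invmx] returns a singular
    matrix unchanged. *)
Theorem proposition1 (R : realType) (m : nat) (tb : \bar R)
    (u : R -> R -> 'M[Cplx R]_m)
    (V Psi : R -> R -> Cplx R -> 'M[Cplx R]_(m + m))
    (M : R -> Cplx R -> 'M[Cplx R]_m)
    (m_ge1 : (1 <= m)%N)
    (tb_gt0 : (0 < tb)%E)
    (u_bounded : bounded_potential tb u)
    (u_sa : self_adjoint tb u)
    (u_KdV : KdV tb u)
    (G_C1 : forall z : Cplx R,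
      continuously_differentiable tb (fun x t => Gmx u x t z))
    (F_C1 : forall z : Cplx R,
      continuously_differentiable tb (fun x t => Fmx u x t z))
    (V_sol : solves_V tb u V)
    (Psi_sol : solves_Psi tb u Psi)
    (M_Weyl : forall t, times tb t -> is_Weyl_function Psi t (M t)) :
  forall (t : R) (z : Cplx R), times tb t -> 0 < 'Im z ->
    let r11 := ulsubmx (Rmx V t z) in
    let r12 := ursubmx (Rmx V t z) in
    let r21 := dlsubmx (Rmx V t z) in
    let r22 := drsubmx (Rmx V t z) in
    (- 'i *: (r21 *m M 0 z) + r22 \in unitmx) /\
    M t z = 'i *: ((- 'i *: (r11 *m M 0 z) + r12)
                     *m invmx (- 'i *: (r21 *m M 0 z) + r22)).
Proof.
move=> t z Tt Imz r11 r12 r21 r22.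
have z0 : 0 < imC z by move: Imz; rewrite -complexIm -(toC_lt 0).
have T0 := times0 Tt.
pose w0 := col_mx 1%:M (- 'i *: M 0 z).
pose W := Tmx^t* *m V 0 t z *m Tmx *m w0.
have VF := V_form u_sa G_C1 F_C1 V_sol z Tt.
(* The swap by J puts the numerator of the fraction in the lower block of W and the denominator in
   the upper one. *)
have RW : Rmx V t z *m col_mx (- 'i *: M 0 z) 1%:M = Jmx *m W.
  rewrite (RmxE VF) /W /w0; move: (Tmx^t* *m _ *m _) => X.
  by rewrite -!mulmxA Jmx_col.
have TW v : Tmx *m (W *m v) = V 0 t z *m (Tmx *m (w0 *m v)).
  by rewrite /W; move: (V 0 t z) => X; rewrite !mulmxA Tmx_unitary' mul1mx.
have [c c0 Hc] := flux_characteristic u_bounded u_sa u_KdV G_C1 F_C1 V_sol Psi_sol z0.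
have pos l (v : 'cV_m) : 0 <= l -> 0 <= flux (Psi l t z *m (Tmx *m (W *m v))).
  move=> l0; rewrite TW; apply: le_trans (Hc t l _ Tt l0).
  rewrite /w0; apply: (Weyl_disk u_sa Psi_sol T0 z0 (M_Weyl 0 T0)).
  by rewrite addr_ge0 // mulr_ge0 ?(times_ge0 Tt) // ltW.
have inj (v : 'cV_m) : W *m v = 0 -> v = 0.
  move=> Wv; have := TW _ v; rewrite Wv mulmx0 => /esym /(congr1 (mulmx (invmx (V 0 t z)))).
  rewrite mulKmx ?(K_unit VF) // mulmx0 => /(congr1 (mulmx (Tmx^t*))).
  rewrite [Tmx^t* *m (Tmx *m _)]mulmxA Tmx_unitary mul1mx mulmx0 /w0 mul_col_mx mul1mx.
  by rewrite -col_mx0 => /eq_col_mx[].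
move: RW; rewrite -[Rmx V t z]submxK -/r11 -/r12 -/r21 -/r22.
move: r11 r12 r21 r22 => r11 r12 r21 r22; rewrite mul_block_col !mulmx1.
rewrite -!scalemxAr -[W]vsubmxK Jmx_col => /eq_col_mx[-> ->].
apply: (Weyl_function_unique u_sa Psi_sol Tt z0 (M_Weyl t Tt)); rewrite vsubmxK //.
Qed.
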